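(* For any region $R$ in the on-shell expansion of a wide-angle scattering graph $G$, with subgraphs $H,J_1,\dots,J_K,S$, the leading Lee-Pomeransky polynomial takes the form $$\mathcal P_0^{(R)}(\boldsymbol x;\boldsymbol s)=\mathcal U^{(R)}(\boldsymbol x)+\mathcal F^{(R)}(\boldsymbol x;\boldsymbol s),$$ $$\mathcal F^{(R)}(\boldsymbol x;\boldsymbol s)=\sum_{i=1}^K\mathcal F^{(p_i^2,R)}(\boldsymbol x;\boldsymbol s)+\mathcal F_{\mathrm I}^{(q^2,R)}(\boldsymbol x;\boldsymbol s)+\sum_{i>j=1}^K\mathcal F_{\mathrm{II}}^{(q_{ij}^2,R)}(\boldsymbol x;\boldsymbol s),$$ and these polynomials factorise as $$\mathcal U^{(R)}(\boldsymbol x)=\mathcal U_H(\boldsymbol x^{[H]})\cdot\Big(\prod_{i=1}^K\mathcal U_{J_i}(\boldsymbol x^{[J_i]})\Big)\cdot\mathcal U_S(\boldsymbol x^{[S]}),$$ $$\mathcal F^{(p_i^2,R)}(\boldsymbol x;\boldsymbol s)=\mathcal U_H(\boldsymbol x^{[H]})\cdot\mathcal F_{J_i}^{(p_i^2)}(\boldsymbol x^{[J_i]};\boldsymbol s)\cdot\Big(\prod_{j\neq i}\mathcal U_{J_j}(\boldsymbol x^{[J_j]})\Big)\cdot\mathcal U_S(\boldsymbol x^{[S]}),$$ $$\mathcal F_{\mathrm I}^{(q^2,R)}(\boldsymbol x;\boldsymbol s)=\mathcal F_{H\cup J}^{(q^2)}(\boldsymbol x^{[H]},\boldsymbol x^{[J]})\cdot\mathcal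 U_S(\boldsymbol x^{[S]}),$$ $$\mathcal F_{\mathrm{II}}^{(q_{ij}^2,R)}(\boldsymbol x;\boldsymbol s)=\mathcal U_H(\boldsymbol x^{[H]})\cdot\mathcal F_{J_i\cup J_j\cup S}^{(q_{ij}^2)}(\boldsymbol x^{[J_i]},\boldsymbol x^{[J_j]},\boldsymbol x^{[S]})\cdot\prod_{k\neq i,j}\mathcal U_{J_k}(\boldsymbol x^{[J_k]}).$$
   Context: Graphs and kinematics. $G$ is a finite connected Feynman graph with $N$ massless internal edges. Its external momenta $p_1,\dots,p_K,q_1,\dots,q_M$ sum to zero, are non-exceptional, and satisfy, for $\lambda\ll1$ and a hard scale $Q^2$: $p_i^2\sim\lambda Q^2$, $q_j^2\sim Q^2$, $p_k\cdot p_l\sim Q^2$ ($k\neq l$). Such a $G$ is called a wide-angle scattering graph. The square of the total external momentum entering one side of a cut is $0$ if one side has no external momenta, $p_i^2$ if one side contains exactly the single external momentum $p_i$, and of order $\lambda^0Q^2$ (off-shell) otherwise. For a graph $\gamma$, $L(\gamma)$ is its number of loops. Lee-Pomeransky polynomial. $\mathcal P=\mathcal U+\mathcal F$, $\mathcal U=\sum_{T^1}\prod_{e\notin T^1}x_e$ (spanning trees), $\mathcal F=-\sum_{T^2}s_{T^2}\prod_{e\notin T^2}x_e$ (spanning 2-trees, i.e. spanning forests with two components; $s_{T^2}$ is the square of the momentum flowing between the two components). After $p_i^2\to\lambda p_i^2$, each monomial $x_1^{r_1}\cdots x_N^{r_N}\lambda^{r_{N+1}}$ with nonzero coefficient has exponent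 vector $\boldsymbol r=(r_1,\dots,r_N;r_{N+1})$; the Newton polytope is the convex hull of these in $\mathbb R^{N+1}$. Regions. A region $R$ is a lower facet of the Newton polytope (an $N$-dimensional face with inward normal $\boldsymbol v_R=(\boldsymbol u_R;1)$); in the on-shell expansion it has the following form: the edges of $G$ are partitioned into $H$ (hard), $J_1,\dots,J_K$ (jets) and $S$ (soft) with $u_{R,e}=0,-1,-2$ for $e\in H$, $e\in J=\cup_iJ_i$, $e\in S$. A vertex is in $S$ iff it meets only soft edges; in $J_i$ iff it meets at least one edge of $J_i$, possibly soft edges, but no edge of $H$ or $J_j$, $j\ne i$; otherwise in $H$. Moreover $H$, to which all $q_j$ are attached, is connected; each $J_i$ is connected and attached to $H$, with only external momentum $p_i$; $S$ has no external momenta and each of its connected components is attached to $H\cup J$. The leading polynomial $\mathcal P_0^{(R)}$ is the sum of those terms of $\mathcal P$ (with coefficients, at $\lambda=1$) whose exponent vectors minimise $\boldsymbol r\cdot\boldsymbol v_R$. Contracted graphs. $\widetilde S$ is obtained from $S$ by identifying all vertices of $H\cup J$ to which $S$ is attached into one auxiliary vertex; $\widetilde J_i$ is obtained from $J_i$ by identifying all vertices of $H$ to which $J_i$ is attached into one auxiliary vertex. Notation. $\boldsymbol x^{[H]},\boldsymbol x^{[J_i]},\boldsymbol x^{[J]},\boldsymbol x^{[S]}$ are the parameters of the edges in $H,J_i,J,S$. $q_{ij}=p_i+p_j$. $\mathcal U^{(R)}$ is the part of $\mathcal P_0^{(R)}$ coming from $\mathcal U$, $\mathcal F^{(R)}$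 the part coming from $\mathcal F$. $\mathcal F^{(p_i^2,R)}$ collects the terms of $\mathcal F^{(R)}$ with kinematic factor $p_i^2$. $\mathcal F_{\mathrm I}^{(q^2,R)}$ collects the terms of $\mathcal F^{(R)}$ with off-shell kinematic factor for which $H\cap T^2$ is a spanning 2-tree of $H$. $\mathcal F_{\mathrm{II}}^{(q_{ij}^2,R)}$ collects the terms of $\mathcal F^{(R)}$ with kinematic factor $q_{ij}^2$ for which $H\cap T^2$ is a spanning tree of $H$, $\widetilde J_i\cap T^2$ and $\widetilde J_j\cap T^2$ are spanning 2-trees of $\widetilde J_i$ and $\widetilde J_j$, and $\widetilde S\cap T^2$ has exactly one loop (corresponding to a path of soft edges joining $J_i$ and $J_j$). $\mathcal U_H,\mathcal U_{J_i},\mathcal U_S$ are the spanning-tree polynomials $\sum_{T^1(\gamma)}\prod_{e\in\gamma\setminus T^1(\gamma)}x_e$ for $\gamma=H,\widetilde J_i,\widetilde S$ respectively. $\mathcal F^{(p_i^2)}_{J_i}$ is the polynomial of the spanning 2-trees of $\widetilde J_i$ for which the momentum flowing between the two components is exactly $p_i$ (including the factor $-p_i^2$). $\mathcal F^{(q^2)}_{H\cup J}$ is a polynomial in $\boldsymbol x^{[H]},\boldsymbol x^{[J]}$ only (with off-shell kinematic coefficients) whose terms correspond to spanning 2-trees of $H\cup J$ with off-shell momentum flowing between the components. $\mathcal F^{(q_{ij}^2)}_{J_i\cup J_j\cup S}$ is a polynomial in $\boldsymbol x^{[J_i]},\boldsymbol x^{[J_j]},\boldsymbol x^{[S]}$ only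 (with factor $-q_{ij}^2$) whose terms correspond to spanning 2-trees of the graph $J_i\cup J_j\cup S$ (the rest $H\cup\bigcup_{k\ne i,j}J_k$ being contracted to a point) with momentum exactly $q_{ij}$ flowing between the components. *)

(* Defs.v *)
From mathcomp Require Export all_boot all_order all_algebra.
From mathcomp Require Export mpoly.

Set Implicit Arguments.
Unset Strict Implicit.
Unset Printing Implicit Defensive.

Import Order.TTheory GRing.Theory Num.Theory.
Local Open Scope ring_scope.

(* External legs: [inl i] carries p_i, [inr j] carries q_j. *)
Definition leg (K M : nat) : finType := ('I_K + 'I_M)%type.

(* Multigraphs whose edges are drawn from a fixed list of N edges, so that a
   graph, its subgraphs and their contractions share the parameters x_e; only
   the values of [src] and [tgt] on [edges] matter.  [att] tells at which vertex
   each external leg enters. *)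
Record graph (K M N : nat) (V : finType) := Graph {
  verts : {set V};
  edges : {set 'I_N};
  src : 'I_N -> V;
  tgt : 'I_N -> V;
  att : leg K M -> V }.

Record feynman_graph (K M N : nat) (V : finType) := FeynmanGraph {
  fg_src : 'I_N -> V;
  fg_tgt : 'I_N -> V;
  fg_att : leg K M -> V }.

Section Graphs.
Variables (K M N : nat).

Section Trees.
Variables (V : finType) (g : graph K M N V).
Implicit Types T : {set 'I_N}.

Definition adj T : rel V := fun v w =>
  [exists e in T, ((src g e == v) && (tgt g e == w))
               || ((src g e == w) && (tgt g e == v))].

Definition ncomp T : nat := n_comp (adj T) (verts g).

(* The number of loops |T| - |V| + (number of components); the truncated
   subtraction is harmless as |V| <= |T| + ncomp T. *)
Definition loops T : nat := (#|T| + ncomp T - #|verts g|)%N.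

Definition spanning_tree (k : nat) T : bool :=
  [&& T \subset edges g, ncomp T == k & loops T == 0].

(* The legs entering one of the two components of a spanning 2-tree: the
   component of an arbitrarily picked vertex.  The notions below do not depend
   on which component is picked. *)
Definition side T : {set leg K M} :=
  if [pick v in verts g] is Some v
  then [set l | connect (adj T) v (att g l)] else set0.

End Trees.

(* Which legs a cut separates, up to exchanging the two sides. *)
Definition no_ext (A : {set leg K M}) : bool := (A == set0) || (~: A == set0).
Definition splits (B A : {set leg K M}) : bool := (A == B) || (~: A == B).
Definition p_cut (i : 'I_K) (A : {set leg K M}) : bool :=
  splits [set inl i] A.
Definition on_shell (A : {set leg K M}) : bool := [exists i, p_cut i A].
Definition off_shell (A : {set leg K M}) : bool := ~~ no_ext A && ~~ on_shell A.
Definition pp_cut (i j : 'I_K) (A : {set leg K M}) : bool :=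
  splits [set inl i; inl j] A.

Section Sub.
Variables (V : finType) (G : feynman_graph K M N V).

Definition subgraph (W : {set V}) (F : {set 'I_N}) : graph K M N V :=
  Graph W F (fg_src G) (fg_tgt G) (fg_att G).

Definition whole : graph K M N V := subgraph setT setT.

(* The edges F with all vertices outside W identified into the auxiliary vertex
   [None], which is present even if F is empty. *)
Definition keep (W : {set V}) (v : V) : option V :=
  if v \in W then Some v else None.

Definition contracted (W : {set V}) (F : {set 'I_N}) : graph K M N (option V) :=
  Graph (None |: Some @: W) F (fun e => keep W (fg_src G e))
    (fun e => keep W (fg_tgt G e)) (fun l => keep W (fg_att G l)).

Definition incident (e : 'I_N) (v : V) : bool :=
  (fg_src G e == v) || (fg_tgt G e == v).

Variables (H : {set 'I_N}) (J : 'I_K -> {set 'I_N}) (S : {set 'I_N}).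

Definition soft_verts : {set V} :=
  [set v | [forall e, incident e v ==> (e \in S)]].
Definition jet_verts (i : 'I_K) : {set V} :=
  [set v | [exists e in J i, incident e v]
        && [forall e, incident e v ==> (e \in J i :|: S)]].
Definition hard_verts : {set V} :=
  ~: (soft_verts :|: \bigcup_i jet_verts i).

Definition hard_graph := subgraph hard_verts H.
Definition jet_tilde (i : 'I_K) := contracted (jet_verts i) (J i).
Definition soft_tilde := contracted soft_verts S.
Definition hard_jet_graph :=
  subgraph (hard_verts :|: \bigcup_i jet_verts i) (H :|: \bigcup_i J i).
Definition jet_jet_soft (i j : 'I_K) :=
  contracted (jet_verts i :|: jet_verts j :|: soft_verts) (J i :|: J j :|: S).

(* J_i has the vertices [jet_verts i]; its edges may also end on H, and it must
   be connected without passing through H.  J_i may be empty, in which case p_i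
   enters H directly. *)
Record region_shape : Prop := RegionShape {
  rs_partition : forall e,
    ((e \in H) + \sum_i (e \in J i) + (e \in S))%N = 1%N;
  rs_hard_connected : ncomp hard_graph H = 1%N;
  rs_q_hard : forall j, fg_att G (inr j) \in hard_verts;
  rs_jet_connected : forall i, {in jet_verts i &, forall v w,
    connect [rel a b | [&& a \in jet_verts i, b \in jet_verts i
                         & adj whole (J i) a b]] v w};
  rs_jet_edges : forall i, {in J i, forall e,
    (fg_src G e \in jet_verts i) || (fg_tgt G e \in jet_verts i)};
  rs_jet_attached : forall i, J i != set0 ->
    exists2 e, e \in J i & exists2 v, v \in hard_verts & incident e v;
  rs_p_jet : forall i,
    fg_att G (inl i) \in (if J i == set0 then hard_verts else jet_verts i);
  rs_soft_noext : forall l, fg_att G l \notin soft_verts;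
  rs_soft_attached : {in soft_verts, forall v,
    exists2 w, w \notin soft_verts & connect (adj whole S) v w} }.

End Sub.
End Graphs.

Section Polynomials.
Variables (R : realFieldType) (d K M N : nat).
Implicit Types mom : leg K M -> 'rV[R]_d.+1.

(* The Lorentz product with signature (+,-,...,-). *)
Definition mdot (a b : 'rV[R]_d.+1) : R :=
  a 0 0 * b 0 0 - \sum_(i < d) a 0 (lift ord0 i) * b 0 (lift ord0 i).

Definition msq mom (A : {set leg K M}) : R :=
  mdot (\sum_(l in A) mom l) (\sum_(l in A) mom l).

(* f(lam) ~ lam^k Q2 as lam -> 0, with lam1 fixing what "small" means. *)
Definition scales (lam1 Q2 : R) (k : nat) (f : R -> R) : Prop :=
  exists c C : R, [/\ 0 < c, 0 < C & forall lam, 0 < lam <= lam1 ->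
    c * (lam ^+ k * Q2) <= `|f lam| <= C * (lam ^+ k * Q2)].

(* Wide-angle kinematics: a family of momenta depending on the small parameter
   lam; a cut is a bipartition of the vertices. *)
Record wide_angle (V : finType) (G : feynman_graph K M N V) (lam1 Q2 : R)
    (mom : R -> leg K M -> 'rV[R]_d.+1) : Prop := WideAngle {
  wa_lam1 : 0 < lam1;
  wa_Q2 : 0 < Q2;
  wa_conservation : forall lam, 0 < lam <= lam1 -> \sum_l mom lam l = 0;
  wa_nonexceptional : forall lam, 0 < lam <= lam1 -> forall A : {set leg K M},
    ~~ no_ext A -> \sum_(l in A) mom lam l != 0;
  wa_pp : forall i, scales lam1 Q2 1 (fun lam =>
    mdot (mom lam (inl i)) (mom lam (inl i)));
  wa_qq : forall j, scales lam1 Q2 0 (fun lam =>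
    mdot (mom lam (inr j)) (mom lam (inr j)));
  wa_pkpl : forall k l, k != l -> scales lam1 Q2 0 (fun lam =>
    mdot (mom lam (inl k)) (mom lam (inl l)));
  wa_cuts : forall W : {set V}, off_shell [set l | fg_att G l \in W] ->
    scales lam1 Q2 0 (fun lam => msq (mom lam) [set l | fg_att G l \in W]) }.

Section GraphPolynomials.
Variables (n : nat) (x : 'I_N -> {mpoly R[n]}).
Variables (V : finType) (g : graph K M N V).

Definition Upoly : {mpoly R[n]} :=
  \sum_(T : {set 'I_N} | spanning_tree g 1 T) \prod_(e in edges g :\: T) x e.

(* The terms of F selected by [sel], each kinematic factor p_i^2 being
   accompanied by a factor l. *)
Definition Fpoly mom (l : {mpoly R[n]}) (sel : pred {set 'I_N}) :
    {mpoly R[n]} :=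
  - \sum_(T : {set 'I_N} | spanning_tree g 2 T && sel T)
      msq mom (side g T) *:
        (l ^+ on_shell (side g T) * \prod_(e in edges g :\: T) x e).

End GraphPolynomials.

Section Newton.
Variable n : nat.
Implicit Types (P Q : {mpoly R[n]}) (v y : 'rV[R]_n).

Definition dot v y : R := \sum_i v 0 i * y 0 i.

Definition exponent (m : 'X_{1..n}) : 'rV[R]_n := \row_i (m i)%:R.

Definition newton_polytope P : 'rV[R]_n -> Prop := fun y =>
  exists w : 'X_{1..n} -> R,
    [/\ forall m, 0 <= w m, \sum_(m <- msupp P) w m = 1
      & y = \sum_(m <- msupp P) w m *: exponent m].

Definition face (A : 'rV[R]_n -> Prop) v : 'rV[R]_n -> Prop := fun y =>
  A y /\ forall z, A z -> dot v y <= dot v z.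

Definition affinely_independent k (a : 'I_k.+1 -> 'rV[R]_n) : bool :=
  row_free (\matrix_(i < k) (a (lift ord0 i) - a ord0)).

Definition has_dim (A : 'rV[R]_n -> Prop) (k : nat) : Prop :=
  (exists a : 'I_k.+1 -> 'rV[R]_n, (forall i, A (a i)) /\ affinely_independent a)
  /\ ~ (exists a : 'I_k.+2 -> 'rV[R]_n,
          (forall i, A (a i)) /\ affinely_independent a).

(* The terms of Q whose exponent vectors minimise the product with v among all
   the exponent vectors of P. *)
Definition leading v P Q : {mpoly R[n]} :=
  \sum_(m <- msupp Q | all (fun m' =>
      dot v (exponent m) <= dot v (exponent m')) (msupp P)) Q@_m *: 'X_[m].

End Newton.

(* Among N.+1 variables the last one is lambda, the others are the x_e.  This
   lambda is the formal symbol introduced by p_i^2 -> lambda p_i^2; the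
   coefficients are those of fixed momenta. *)
Definition xl (e : 'I_N) : {mpoly R[N.+1]} := 'X_(lift ord_max e).
Definition lambda : {mpoly R[N.+1]} := 'X_ord_max.

Definition at_lambda1 (P : {mpoly R[N.+1]}) : {mpoly R[N]} :=
  P \mPo [tuple if unlift ord_max j is Some e then 'X_e else 1 | j < N.+1].

Definition xv (e : 'I_N) : {mpoly R[N]} := 'X_e.

Variables (V : finType) (G : feynman_graph K M N V).
Variable mom : leg K M -> 'rV[R]_d.+1.

Definition U_lambda : {mpoly R[N.+1]} := Upoly xl (whole G).
Definition F_lambda (sel : pred {set 'I_N}) : {mpoly R[N.+1]} :=
  Fpoly xl (whole G) mom lambda sel.
Definition LeePomeransky : {mpoly R[N.+1]} := U_lambda + F_lambda predT.

Variables (H : {set 'I_N}) (J : 'I_K -> {set 'I_N}) (S : {set 'I_N}).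

Definition normal_vector : 'rV[R]_N.+1 := \row_j
  (if unlift ord_max j is Some e
   then (if e \in H then 0 else if e \in S then - 2%:R else - 1) else 1).

Definition is_region : Prop :=
  region_shape G H J S /\
  has_dim (face (newton_polytope LeePomeransky) normal_vector) N.

Definition leading_part (Q : {mpoly R[N.+1]}) : {mpoly R[N]} :=
  at_lambda1 (leading normal_vector LeePomeransky Q).

Definition P0_R := leading_part LeePomeransky.
Definition U_R := leading_part U_lambda.
Definition F_R := leading_part (F_lambda predT).

Definition Fp_R (i : 'I_K) :=
  leading_part (F_lambda (fun T => p_cut i (side (whole G) T))).

Definition FI_R :=
  leading_part (F_lambda (fun T => off_shell (side (whole G) T) &&
    spanning_tree (hard_graph G H J S) 2 (T :&: H))).

Definition FII_R (i j : 'I_K) :=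
  leading_part (F_lambda (fun T => [&& pp_cut i j (side (whole G) T),
    spanning_tree (hard_graph G H J S) 1 (T :&: H),
    spanning_tree (jet_tilde G J S i) 2 (T :&: J i),
    spanning_tree (jet_tilde G J S j) 2 (T :&: J j)
    & loops (soft_tilde G S) (T :&: S) == 1])).

Definition U_H := Upoly xv (hard_graph G H J S).
Definition U_J (i : 'I_K) := Upoly xv (jet_tilde G J S i).
Definition U_S := Upoly xv (soft_tilde G S).

Definition Fp_J (i : 'I_K) :=
  let g := jet_tilde G J S i in
  Fpoly xv g mom 1 (fun T => p_cut i (side g T)).

(* The spanning 2-trees of H \cup J and of J_i \cup J_j \cup S that contribute
   are the leading ones, singled out by the same conditions as in [FI_R] and
   [FII_R]; the remaining ones with the same momentum flow are subleading. *)
Definition Fq_HJ :=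
  let g := hard_jet_graph G H J S in
  Fpoly xv g mom 1 (fun T => off_shell (side g T) &&
    spanning_tree (hard_graph G H J S) 2 (T :&: H)).

Definition Fqij_JJS (i j : 'I_K) :=
  let g := jet_jet_soft G J S i j in
  Fpoly xv g mom 1 (fun T => [&& pp_cut i j (side g T),
    spanning_tree (jet_tilde G J S i) 2 (T :&: J i),
    spanning_tree (jet_tilde G J S j) 2 (T :&: J j)
    & loops (soft_tilde G S) (T :&: S) == 1]).

End Polynomials.

(* Main.v *)
(* Minus the normal vector gives the edges of H, J and S the weights 0, 1 and 2,
   so the exponent vector of the term of a spanning tree or spanning 2-tree T has
   as product with it, up to a constant, the weight of T, plus one if T carries a
   factor p_i^2.  Work in the graphic matroid of G.  Contracting H and then the
   jets shows that the spanning trees of least weight w0 are those whose traces on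
   H, the J_i and S are spanning trees of H, the \tilde J_i and \tilde S.
   A 2-tree of nonzero kinematic factor that disconnects the vertices of H has
   weight at least w0.  If it connects them, let m >= 1 be the number of jets with
   vertices on the side of the cut away from H; every such jet lowers the rank of
   the trace on H \cup J by one, so that the weight is at least w0 - 2 + m, and
   the external momentum on that side enters through these jets.  Hence the
   leading 2-trees have either an on-shell cut {p_i} with m = 1, or an off-shell
   cut which disconnects H (type I) or has m = 2 (type II), and equality in the
   rank estimates tells what their traces on H, the J_i and S are.  A spanning
   forest can be read off its monomial, so nothing cancels, and every identity can
   be checked coefficientwise: a product of sums over subsets of disjoint edge sets
   is the sum over the subsets of their union whose traces meet the conditions. *)
Require Import Defs.
From mathcomp Require Import zify ring lra.
Import Order.TTheory GRing.Theory Num.Theory.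
Set Implicit Arguments.
Unset Strict Implicit.
Unset Printing Implicit Defensive.
Local Open Scope nat_scope.

(* [lia] compares atoms syntactically, but unification leaves some of the types of
   sets wrapped in [reverse_coercion]. *)
Ltac nlia := unfold reverse_coercion in *;
  cbn [Finite.sort fintype_ordinal__canonical__fintype_Finite] in *; lia.

(** * Spanning forests and the graphic matroid *)

(** All counting takes place in one graph, [whole G]. A vertex outside a subgraph only adds an
    isolated component, and contracting vertices that are connected by a set X of edges amounts to
    adding X to the edge set; so every tree condition on a derived graph becomes a pair of equations
    between cardinals and values of [ncomp]. The weights 0, 1, 2 count which of the nested sets H
    and HJ (hard and jet edges) miss an edge, whence weight T = 2|T| - |T :&: HJ| - |T :&: H|. Least
    weight therefore means largest traces along this flag, and the rank estimates bound exactly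
    these two numbers. Since [side] starts from an uncontrolled vertex, cuts are described from a
    fixed vertex h0 of H instead; all predicates and squared momenta involved are invariant under
    complement, the latter by momentum conservation. Kinematics yields three facts: cuts without
    external momentum have coefficient 0; there are at least three legs if K > 0, so that the cuts
    {p_i} are distinct; a cut {p_i, p_j} is never on-shell. The last two make the classes of leading
    2-trees disjoint. *)

Lemma n_comp_quot (T T' : finType) (e : rel T) (e' : rel T') (h : T -> T')
    (a : {pred T}) (a' : {pred T'}) :
  connect_sym e -> connect_sym e' -> closed e a -> closed e' a' ->
  {in a, forall x, h x \in a'} ->
  {in a', forall y, exists2 x, x \in a & connect e' y (h x)} ->
  {in a &, forall x y, connect e' (h x) (h y) = connect e x y} ->
  n_comp e a = n_comp e' a'.
Proof.
move=> sym_e sym_e' cl_a cl_a' ha hsurj hconn.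
have inj_h : {in predI (roots e) a &, injective (fingraph.root e' \o h)}.
  move=> x y /andP[/eqP rx ax] /andP[/eqP ry ay] /= /(fingraph.rootP sym_e').
  by rewrite hconn // => /(fingraph.rootP sym_e); rewrite rx ry.
rewrite /n_comp_mem -(card_in_image inj_h); apply: eq_card => y.
apply/imageP/andP => [[x /andP[_ ax] ->] | [/eqP ry ay]] /=.
  split; first exact: roots_root.
  by rewrite -(closed_connect cl_a' (connect_root _ _)) ha.
have [x ax yx] := hsurj y ay; exists (fingraph.root e x).
  apply/andP; split; first exact: roots_root.
  by have := closed_connect cl_a (connect_root e x); rewrite ax => /esym.
rewrite -ry; apply/(fingraph.rootP sym_e'); apply: connect_trans yx _.
by rewrite hconn ?connect_root // -(closed_connect cl_a (connect_root _ _)).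
Qed.

Lemma finset_ind n (P : {set 'I_n} -> Prop) :
  P set0 -> (forall i A, P A -> P (i |: A)) -> forall A, P A.
Proof.
move=> P0 PU A; rewrite -[A]set_enum; elim: (enum A) => [|i s IH].
  by rewrite set_nil.
by rewrite set_cons; apply: PU.
Qed.

Section GraphTheory.
Variables (K M N : nat) (V : finType) (g : graph K M N V).
Implicit Types (T X Y Z : {set 'I_N}) (e : 'I_N) (v w : V).

Definition conn T := connect (adj g T).

Definition ends_in (W : {set V}) T :=
  {in T, forall e, (src g e \in W) && (tgt g e \in W)}.

Lemma adjP T v w :
  reflect (exists2 e, e \in T & ((src g e == v) && (tgt g e == w))
             || ((src g e == w) && (tgt g e == v))) (adj g T v w).
Proof. exact: exists_inP. Qed.

Lemma adj_csym T : connect_sym (adj g T).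
Proof.
apply: sym_connect_sym => v w.
by apply/adjP/adjP => -[e eT]; rewrite orbC => ?; exists e.
Qed.

Lemma conn_sym T : ssrbool.symmetric (conn T). Proof. exact: adj_csym. Qed.

Lemma conn_trans T : transitive (conn T). Proof. exact: connect_trans. Qed.

Lemma conn_edge T e : e \in T -> conn T (src g e) (tgt g e).
Proof. by move=> eT; apply/connect1/adjP; exists e; rewrite ?eqxx. Qed.

Lemma ends_inS (W W' : {set V}) T T' :
  W' \subset W -> T \subset T' -> ends_in W' T' -> ends_in W T.
Proof.
move=> sW sT wT e /(subsetP sT)/wT/andP[es et].
by rewrite !(subsetP sW).
Qed.

Lemma ends_inU (W : {set V}) T T' : ends_in W T -> ends_in W T' -> ends_in W (T :|: T').
Proof. by move=> h h' e; rewrite inE => /orP[/h|/h']. Qed.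

Lemma ends_in_closed (W : {set V}) T : ends_in W T -> closed (adj g T) W.
Proof.
move=> wT v w /adjP[e /wT/andP[sW tW]].
by case/orP=> /andP[/eqP<- /eqP<-]; rewrite sW tW.
Qed.

(* The edges of Y lie in the closure of X in the graphic matroid. *)
Definition spans X Y := {in Y, forall e, conn X (src g e) (tgt g e)}.

Lemma spans_conn X Y v w : spans X Y -> conn Y v w -> conn X v w.
Proof.
move=> XY; apply: connect_sub => a b /adjP[e /XY se].
by case/orP=> /andP[/eqP<- /eqP<-] //; rewrite adj_csym.
Qed.

Lemma subset_spans X Y : Y \subset X -> spans X Y.
Proof. by move=> sYX e /(subsetP sYX)/conn_edge. Qed.

Lemma conn_sub X Y v w : X \subset Y -> conn X v w -> conn Y v w.
Proof. by move=> sXY; apply/spans_conn/subset_spans. Qed.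

Lemma spans_trans X Y Z : spans X Y -> spans Y Z -> spans X Z.
Proof. by move=> XY YZ e /YZ; apply: spans_conn. Qed.

Lemma spansU X Y Z : spans X Y -> spans X Z -> spans X (Y :|: Z).
Proof. by move=> XY XZ e; rewrite inE => /orP[/XY|/XZ]. Qed.

Lemma spans_ncomp X Y : spans X Y -> spans Y X -> ncomp g X = ncomp g Y.
Proof.
move=> XY YX; apply: eq_n_comp => v w.
by apply/idP/idP; apply: spans_conn.
Qed.

(** A path through e can be shortened so as to cross e only once, in one of the two directions. *)
Lemma conn_addE T e v w : conn (e |: T) v w =
  [|| conn T v w, conn T v (src g e) && conn T w (tgt g e)
    | conn T v (tgt g e) && conn T w (src g e)].
Proof.
apply/idP/idP => [|h]; last first.
  have sT : T \subset e |: T by apply: subsetUr.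
  have ste := conn_edge (setU11 e T).
  case/or3P: h => [|/andP[vs wt]|/andP[vt ws]]; first exact: conn_sub.
    apply: conn_trans (conn_sub sT vs) (conn_trans ste _).
    by rewrite conn_sym; apply: conn_sub wt.
  apply: conn_trans (conn_sub sT vt) _; rewrite conn_sym.
  exact: conn_trans (conn_sub sT ws) ste.
case/connectP=> p + ->; elim: p v => [|a p IH] v /=.
  by rewrite /conn connect0.
case/andP=> /adjP[f]; rewrite !inE => fT fva /IH; set b := last _ _.
have cT x y : conn T x y -> conn T x =1 conn T y by apply/same_connect/adj_csym.
have [fT'|] := boolP (f \in T).
  suff va : conn T v a by rewrite !(cT _ _ va).
  by have := conn_edge fT'; case/orP: fva => /andP[/eqP<- /eqP<-]; rewrite // conn_sym.
move=> fT'; have fe : f = e by apply/eqP; move: fT; rewrite (negbTE fT') orbF.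
rewrite {}fe in fva.
have c0 x : conn T x x by apply: connect0.
case/orP: fva => /andP[/eqP<- /eqP<-] /or3P[|/andP[]|/andP[]]; rewrite ?c0 /=.
- by rewrite (conn_sym _ _ b) => ->; rewrite orbT.
- by move=> ts bt; rewrite -(cT _ _ ts b) conn_sym bt.
- by rewrite (conn_sym _ _ b) => _ ->.
- by rewrite (conn_sym _ _ b) => ->; rewrite !orbT.
- by rewrite (conn_sym _ _ b) => _ ->.
- by move=> st bs; rewrite -(cT _ _ st b) conn_sym bs.
Qed.

Section Spanning.
Hypothesis vertsT : verts g = setT.

Lemma ncompE T : ncomp g T = n_comp (adj g T) V.
Proof. by apply: eq_n_comp_r => v; rewrite vertsT !inE. Qed.

(** If the ends of e are not yet connected, the class of e in [e |: T] is one component with e and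
    exactly two without it, and nothing changes outside this class. *)
Lemma ncomp_add T e :
  ncomp g T = ncomp g (e |: T) + ~~ conn T (src g e) (tgt g e).
Proof.
have [se|nse] := boolP (conn T _ _).
  rewrite addn0; apply: spans_ncomp; last by apply/subset_spans/subsetUr.
  by move=> f; rewrite !inE => /orP[/eqP->|/conn_edge].
have c0 x : conn T x x by apply: connect0.
have sT : T \subset e |: T by apply: subsetUr.
pose a : {pred V} := [pred v | conn (e |: T) (src g e) v].
have aE v : (v \in a) = conn T v (src g e) || conn T v (tgt g e).
  rewrite inE /= conn_addE c0 (negbTE nse) /= orbF.
  by rewrite conn_sym.
have cl_a : closed (adj g (e |: T)) a by apply/connect_closed/adj_csym.
have cl_a' : closed (adj g T) a.
  move=> x y /adjP[f fT xy]; apply: cl_a; apply/adjP; exists f => //.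
  by rewrite inE fT orbT.
have na1 : n_comp (adj g (e |: T)) a = 1 by apply/n_comp_connect/adj_csym.
have na2 : n_comp (adj g T) a = 2.
  have <- : (~~ connect (adj g T) (src g e) (tgt g e)).+1 = 2.
    by rewrite -/(conn _ _ _) nse.
  rewrite -(n_comp_closure2 (@adj_csym T)); apply: eq_n_comp_r => v.
  rewrite aE; apply/idP/existsP.
    by case/orP=> h; [exists (src g e) | exists (tgt g e)];
      rewrite !inE eqxx ?orbT andbT.
  by case=> w; rewrite !inE => /andP[vw] /orP[] /eqP<-; rewrite /conn vw ?orbT.
rewrite !ncompE (n_compC a) [in RHS](n_compC a) na1 na2.
suff -> : n_comp (adj g T) [predC a] = n_comp (adj g (e |: T)) [predC a].
  by rewrite /= addnAC.
apply: (@n_comp_quot _ _ _ _ id) => //.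
- exact: adj_csym.
- exact: adj_csym.
- exact: predC_closed.
- exact: predC_closed.
- by move=> y ay; exists y => //; apply: connect0.
- move=> x y; rewrite !inE => /= ax ay; rewrite -!/(conn _ _ _) conn_addE.
  have:= aE x; rewrite inE /= (negbTE ax) => /esym /norP[/negbTE-> /negbTE->].
  by rewrite !orbF.
Qed.

Lemma ncomp0 : ncomp g set0 = #|V|.
Proof.
rewrite ncompE /n_comp_mem; apply: eq_card => v; rewrite !inE /= andbT /roots.
have: connect (adj g set0) v (fingraph.root (adj g set0) v) by apply: connect_root.
by case/connectP=> -[|a p] /= => [_ ->|/andP[/adjP[e]]]; rewrite ?inE ?eqxx.
Qed.

Lemma ncomp_add_le T e : ncomp g (e |: T) <= ncomp g T.
Proof. by rewrite (ncomp_add T e) leq_addr. Qed.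

Lemma ncomp_mono X Y : X \subset Y -> ncomp g Y <= ncomp g X.
Proof.
move/setUidPr <-; elim/finset_ind: Y => [|e Y IH]; first by rewrite setU0.
by rewrite setUCA (leq_trans (ncomp_add_le _ _)).
Qed.

Lemma ncomp_leU X Z : ncomp g X <= ncomp g (X :|: Z) + #|Z :\: X|.
Proof.
elim/finset_ind: Z => [|e Z IH]; first by rewrite setU0 leq_addr.
have [eXZ|] := boolP (e \in X :|: Z).
  rewrite setUCA (setUidPr _) ?sub1set // (leq_trans IH) // leq_add2l.
  by rewrite subset_leq_card // setSD // subsetUr.
rewrite inE => /norP[eX eZ]; rewrite setDUl.
have ->: [set e] :\: X = [set e] by apply/setDidPl; rewrite disjoints1.
rewrite cardsU1 inE (negbTE eZ) andbF /= setUCA.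
by have := ncomp_add (X :|: Z) e; case: (conn _ _ _) => /=; nlia.
Qed.

(* Submodularity of the graphic rank [#|V| - ncomp], as diminishing returns. *)
Lemma ncomp_submod X Y Z : X \subset Y ->
  ncomp g (X :|: Z) + ncomp g Y <= ncomp g X + ncomp g (Y :|: Z).
Proof.
move=> sXY; elim/finset_ind: Z => [|e Z IH]; first by rewrite !setU0.
have sXYZ : X :|: Z \subset Y :|: Z by apply: setSU.
have:= ncomp_add (X :|: Z) e; have:= ncomp_add (Y :|: Z) e; rewrite !(setUCA [set e]).
have: conn (X :|: Z) (src g e) (tgt g e) ==> conn (Y :|: Z) (src g e) (tgt g e).
  by apply/implyP/conn_sub.
by do 2!case: (conn _ _ _) => /=; nlia.
Qed.

(** Turns equality in a rank estimate into spanning: an edge of Y joining two components of X would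
    lower the number of components below that of X. *)
Lemma ncomp_spans X Y : X \subset Y -> ncomp g X <= ncomp g Y -> spans X Y.
Proof.
move=> sXY le e eY; apply/negPn/negP => nc.
have := ncomp_add X e; have : ncomp g Y <= ncomp g (e |: X).
  by apply: ncomp_mono; rewrite subUset sub1set eY.
by rewrite nc; nlia.
Qed.

(** Euler's count for the absence of cycles, that is, independence in the graphic matroid. *)
Definition forest T := #|T| + ncomp g T == #|V|.

Lemma forest_ge T : #|V| <= #|T| + ncomp g T.
Proof. by have := ncomp_leU set0 T; rewrite ncomp0 set0U setD0 addnC. Qed.

Lemma forestS X Y : X \subset Y -> forest Y -> forest X.
Proof.
move=> sXY /eqP fY; apply/eqP/anti_leq; rewrite forest_ge andbT.
have := ncomp_leU X Y; rewrite (setUidPr sXY) cardsD (setIidPr sXY).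
by have := subset_leq_card sXY; nlia.
Qed.

(** A maximal forest between X and Y spans Y, since an edge of Y joining two of its components could
    still be added. *)
Lemma forest_extend X Y : X \subset Y -> forest X ->
  exists T, [/\ X \subset T, T \subset Y, forest T & ncomp g T = ncomp g Y].
Proof.
move=> sXY fX.
have [|T /maxsetP[/andP[fT sTY] maxT] sXT] :=
  @maxset_exists _ (fun T => forest T && (T \subset Y)) X; first by rewrite fX.
exists T; split=> //; apply: spans_ncomp; last exact: subset_spans.
move=> e eY; apply/negPn/negP => nc.
have eT : e \notin T by apply/negP => /conn_edge; apply/negP.
suff /maxT : forest (e |: T) && (e |: T \subset Y).
  by move/(_ (subsetUr _ _)) => eq; rewrite -eq setU11 in eT.
rewrite subUset sub1set eY sTY !andbT /forest cardsU1 eT.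
by move: (ncomp_add T e) fT; rewrite nc /forest => -> /eqP <-; nlia.
Qed.

(** No edge of T meets a vertex outside W, so each such vertex is its own component. This is what
    allows subgraphs to be compared inside one graph. *)
Lemma ncomp_isolated (W : {set V}) T : ends_in W T ->
  ncomp g T = n_comp (adj g T) W + #|~: W|.
Proof.
move=> wT; rewrite ncompE (n_compC W); congr (_ + _).
rewrite /n_comp_mem; apply: eq_card => v; rewrite !inE /= andbC.
have [//|vW] := boolP (v \in W); rewrite /roots.
have: connect (adj g T) v (fingraph.root (adj g T) v) by apply: connect_root.
case/connectP=> -[|a p] /= => [_ ->|/andP[va]]; first by rewrite eqxx.
by case/adjP: va vW => e /wT/andP[sW tW] /orP[] /andP[/eqP<- /eqP<-]; rewrite ?sW ?tW.
Qed.

Lemma ncomp_connected (W : {set V}) T : ends_in W T -> W != set0 ->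
  {in W &, forall v w, conn T v w} -> ncomp g T + #|W| = #|V|.+1.
Proof.
move=> wT /set0Pn[w wW] cW; rewrite (ncomp_isolated wT).
rewrite (eq_n_comp_r (a' := connect (adj g T) w)) => [|v].
  have -> : n_comp (adj g T) (connect (adj g T) w) = 1 by apply/n_comp_connect/adj_csym.
  by rewrite add1n addSn addnC cardsC.
apply/idP/idP => [vW|]; first exact: cW.
by move=> wv; rewrite -(closed_connect (ends_in_closed wT) wv).
Qed.
End Spanning.

Lemma ncomp_pairwise T (vs : seq V) : ends_in (verts g) T ->
  {subset vs <= verts g} -> pairwise (fun v w => ~~ conn T v w) vs ->
  size vs <= ncomp g T.
Proof.
move=> wT sV pw; pose r := fingraph.root (adj g T).
have ur : uniq (map r vs).
  rewrite uniq_pairwise pairwise_map; apply: sub_pairwise pw => v w /=.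
  by rewrite root_connect //; apply: adj_csym.
rewrite -(size_map r) -(card_uniqP ur); apply/subset_leq_card/subsetP => _ /mapP[v vs_v ->].
apply/andP; split; first exact/roots_root/adj_csym.
by have := closed_connect (ends_in_closed wT) (connect_root _ v); rewrite sV.
Qed.

Lemma ncomp1_conn T v w : ends_in (verts g) T -> ncomp g T <= 1 ->
  v \in verts g -> w \in verts g -> conn T v w.
Proof.
move=> wT le1 vV wV; apply/negPn/negP => nvw.
suff: size [:: v; w] <= ncomp g T by rewrite leqNgt ltnS le1.
apply: ncomp_pairwise; rewrite //= ?nvw // => x; rewrite !inE.
by case/orP=> /eqP->.
Qed.

Lemma ncomp2_conn T u v w : ends_in (verts g) T -> ncomp g T <= 2 ->
  u \in verts g -> v \in verts g -> w \in verts g ->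
  ~~ conn T u v -> ~~ conn T u w -> conn T v w.
Proof.
move=> wT le2 uV vV wV nuv nuw; apply/negPn/negP => nvw.
suff: size [:: u; v; w] <= ncomp g T by rewrite leqNgt ltnS le2.
apply: ncomp_pairwise; rewrite //= ?nuv ?nuw ?nvw // => x; rewrite !inE.
by case/or3P=> /eqP->.
Qed.

(** Replaces [side], with a base vertex o that is chosen: a hard vertex, or the auxiliary vertex of
    a contraction. *)
Definition far T o : {set leg K M} := [set l | ~~ conn T o (att g l)].

(** With two components, the vertex picked by [side] lies either with o or opposite to it. Anything
    invariant under complement can thus be computed from [far]. *)
Lemma side_far T o : ends_in (verts g) T -> ncomp g T = 2 -> o \in verts g ->
  (forall l, att g l \in verts g) ->
  side g T = far T o \/ side g T = ~: far T o.
Proof.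
move=> wT n2 oV attV; rewrite /side; case: pickP => [v vV|/(_ o)]; last by rewrite oV.
have [ov|nov] := boolP (conn T o v); [right|left]; apply/setP=> l; rewrite !inE.
  by rewrite negbK; apply/esym/same_connect/ov/adj_csym.
have [ol|nol] := boolP (conn T o (att g l)); last first.
  by apply: (ncomp2_conn wT _ oV) => //; rewrite n2.
by apply: contraNF nov => vl; apply: conn_trans ol _; rewrite conn_sym.
Qed.

End GraphTheory.

Lemma connect_homo (T T' : finType) (e : rel T) (e' : rel T') (f : T -> T') :
  (forall x y, e x y -> connect e' (f x) (f y)) ->
  forall x y, connect e x y -> connect e' (f x) (f y).
Proof.
move=> ee' x y /connectP[p ep ->]; elim: p x ep => [|z p IH] x //=.
by case/andP=> /ee' xz /IH; apply: connect_trans.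
Qed.

(** * Subgraphs and contractions seen in the whole graph *)

Section Translation.
Variables (K M N : nat) (V : finType) (G : feynman_graph K M N V).
Implicit Types (T X F : {set 'I_N}) (W D : {set V}).
Local Notation g := (whole G).

Lemma ncomp_subgraph W F T : ends_in g W T ->
  ncomp (subgraph G W F) T + #|~: W| = ncomp g T.
Proof. by move=> wT; rewrite [RHS](ncomp_isolated (erefl : verts g = _) wT). Qed.

Lemma spanning_tree_subgraph W F k T : ends_in g W T ->
  spanning_tree (subgraph G W F) k T =
  [&& T \subset F, ncomp g T == k + #|~: W| & #|T| + k == #|W|].
Proof.
move=> wT; rewrite -(ncomp_subgraph F wT) eqn_add2r /spanning_tree /loops /=.
case: (T \subset F) => //=; case: eqP => //= <-; rewrite subn_eq0 eqn_leq.
(* Vanishing of the truncated [loops] is only an upper bound on the number of edges; the opposite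
   bound holds for every edge set. *)
have := forest_ge (erefl : verts g = _) T; rewrite -(ncomp_subgraph F wT) -(cardsC W).
by case: (_ <= #|W|) => //=; nlia.
Qed.

(* The vertices D, identified by the contraction, are connected by the edges X in the
   whole graph; contracting then amounts to adding X to the set of edges. *)
Section Contraction.
Variables (W D : {set V}) (F X : {set 'I_N}) (d : V).
Hypotheses (dD : d \in D) (WD : [disjoint W & D]).
Hypotheses (wX : ends_in g D X) (cX : {in D &, forall v w, conn g X v w}).
Local Notation c := (contracted G W F).

Lemma keep_in v : v \in W -> keep W v = Some v.
Proof. by rewrite /keep => ->. Qed.

Lemma keep_out v : v \notin W -> keep W v = None.
Proof. by rewrite /keep => /negbTE->. Qed.

Lemma keep_outD v : v \in D -> keep W v = None.
Proof. by move=> vD; apply: keep_out; rewrite (disjointFl WD). Qed.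

Lemma contracted_verts v : keep W v \in verts c.
Proof.
rewrite !inE /=; have [vW|/keep_out->] := boolP (v \in W); last by rewrite eqxx.
by rewrite (keep_in vW) imset_f ?orbT.
Qed.

Lemma ends_contracted T : ends_in c (verts c) T.
Proof. by move=> e _; rewrite !contracted_verts. Qed.

(** A path of the contraction lifts to the whole graph, its passages through the auxiliary vertex
    being bridged by X; conversely [keep W] collapses every edge of X to [None]. *)
Lemma conn_contracted T v w : ends_in g (W :|: D) T ->
  v \in W :|: D -> w \in W :|: D ->
  conn c T (keep W v) (keep W w) = conn g (T :|: X) v w.
Proof.
(* A section of [keep W], with d representing all the identified vertices. *)
move=> wT vWD wWD; pose back o := if o is Some u then u else d.
have backP u : u \in W :|: D -> conn g (T :|: X) (back (keep W u)) u.
  rewrite inE /keep; case: ifP => [_ _|_ /= uD]; first exact: connect0.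
  by apply: conn_sub (cX dD uD); apply: subsetUr.
apply/idP/idP => [vw|].
  have : conn g (T :|: X) (back (keep W v)) (back (keep W w)).
    apply: connect_homo vw => x y /adjP[e eT /= xy].
    have eTX : e \in T :|: X by rewrite inE eT.
    have /andP[sWD tWD] := wT e eT.
    have st : conn g (T :|: X) (back (keep W (fg_src G e))) (back (keep W (fg_tgt G e))).
      apply: (conn_trans (backP _ sWD)).
      apply: (conn_trans (@conn_edge _ _ _ _ g _ _ eTX)).
      by rewrite conn_sym; apply: backP.
    by case/orP: xy => /andP[/eqP<- /eqP<-] //; rewrite -/(conn _ _ _ _) conn_sym.
  move=> bvw; apply: conn_trans (backP _ wWD); apply: conn_trans bvw.
  by rewrite conn_sym; apply: backP.
apply: connect_homo => x y /adjP[e]; rewrite inE => /orP[eT|/wX/andP[sD tD]] /= xy.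
  apply: connect1; apply/adjP; exists e => //=.
  by case/orP: xy => /andP[/eqP<- /eqP<-]; rewrite !eqxx ?orbT.
by case/orP: xy => /andP[/eqP<- /eqP<-]; rewrite !keep_outD //; apply: connect0.
Qed.

Lemma ncomp_contracted T : ends_in g (W :|: D) T ->
  ncomp c T + #|~: (W :|: D)| = ncomp g (T :|: X).
Proof.
move=> wT; have wTX : ends_in g (W :|: D) (T :|: X).
  by apply: ends_inU => //; apply: ends_inS wX => //; apply: subsetUr.
rewrite (ncomp_isolated (erefl : verts g = _) wTX); congr (_ + _).
symmetry; apply: (@n_comp_quot _ _ _ _ (keep W)).
- exact: adj_csym.
- exact: adj_csym.
- exact: ends_in_closed.
- exact/ends_in_closed/ends_contracted.
- by move=> v _; apply: contracted_verts.
- move=> o; rewrite !inE => /orP[/eqP->|/imsetP[v vW ->]].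
    by exists d; rewrite ?inE ?dD ?orbT // keep_outD ?connect0.
  by exists v; rewrite ?inE ?vW // keep_in ?connect0.
- by move=> v w vWD wWD; apply: conn_contracted.
Qed.

Lemma card_contracted : #|verts c| = #|W|.+1.
Proof.
rewrite /= cardsU1 card_imset; last by move=> ? ? [].
by case: imsetP => [[]|].
Qed.

(** The forest inequality for the contraction, whose vertices need not fill their type. It is read
    off in the whole graph: D is one component of X, and adding T to X removes at most |T|
    components. *)
Lemma contracted_ge T : ends_in g (W :|: D) T -> #|W| < #|T| + ncomp c T.
Proof.
move=> wT; have := ncomp_leU (erefl : verts g = _) X T.
rewrite setUC -(ncomp_contracted wT).
have := ncomp_connected (erefl : verts g = _) wX _ cX.
have -> : D != set0 by apply/set0Pn; exists d.
have := cardsC (W :|: D); rewrite cardsU disjoint_setI0 // cards0 subn0.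
have : #|T :\: X| <= #|T| by apply/subset_leq_card/subsetDl.
by move=> ? ? /(_ isT); nlia.
Qed.

Lemma spanning_tree_contracted k T : ends_in g (W :|: D) T ->
  spanning_tree c k T =
  [&& T \subset F, ncomp g (T :|: X) == k + #|~: (W :|: D)| & #|T| + k == #|W|.+1].
Proof.
move=> wT; rewrite -(ncomp_contracted wT) eqn_add2r /spanning_tree /loops.
rewrite card_contracted; case: (T \subset F) => //=; case: eqP => //= <-.
by rewrite subn_eq0 [RHS]eqn_leq contracted_ge // andbT.
Qed.

Lemma loops_contracted T : ends_in g (W :|: D) T ->
  loops c T + #|W|.+1 + #|~: (W :|: D)| = #|T| + ncomp g (T :|: X).
Proof.
move=> wT; rewrite -(ncomp_contracted wT) /loops card_contracted.
by rewrite subnK ?addnA // contracted_ge.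
Qed.

End Contraction.
End Translation.

(** * Subgraphs of a region *)

Lemma cardsU_disjoint (T : finType) (A B : {set T}) :
  [disjoint A & B] -> #|A :|: B| = #|A| + #|B|.
Proof. by move=> AB; rewrite cardsU disjoint_setI0 // cards0 subn0. Qed.

Lemma card_bigcup_disjoint (I T : finType) (P : pred I) (F : I -> {set T}) :
  (forall i j x, x \in F i -> x \in F j -> i = j) ->
  #|\bigcup_(i | P i) F i| = \sum_(i | P i) #|F i|.
Proof.
move=> disj; rewrite [RHS](eq_bigr (fun i => \sum_(x in F i) 1)) => [|i _]; last first.
  by rewrite sum1_card.
rewrite -sum1_card (exchange_big_dep predT) //= big_mkcond; apply: eq_bigr => x _.
case: bigcupP => [[i Pi xi]|no].
  rewrite (big_pred1 i) // => j; apply/andP/eqP => [[_ xj]|->] //.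
  exact: disj xj xi.
by rewrite big1 // => j /andP[Pj xj]; case: no; exists j.
Qed.

Section Region.
Variables (K M N : nat) (V : finType) (G : feynman_graph K M N V).
Variables (H : {set 'I_N}) (J : 'I_K -> {set 'I_N}) (S : {set 'I_N}).
Hypothesis shape : region_shape G H J S.
Implicit Types (T X Y F : {set 'I_N}) (W D : {set V}) (e : 'I_N) (v w : V) (i j k : 'I_K).
Local Notation g := (whole G).
Local Notation VH := (hard_verts G J S).
Local Notation VJ := (jet_verts G J S).
Local Notation VS := (soft_verts G S).
Local Notation HJ := (H :|: \bigcup_i J i).

Lemma jet_inj i j e : e \in J i -> e \in J j -> i = j.
Proof.
move=> ei ej; apply/eqP/negPn/negP => nij; have := rs_partition shape e.
rewrite (bigD1 i) //= (bigD1 j) 1?eq_sym //= ei ej; lia.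
Qed.

Lemma hard_jetF i e : e \in H -> e \in J i = false.
Proof.
move=> eH; apply/negP => ei; have := rs_partition shape e.
by rewrite (bigD1 i) //= ei eH; lia.
Qed.

Lemma hard_softF e : e \in H -> e \in S = false.
Proof. by move=> eH; apply/negP => eS; have := rs_partition shape e; rewrite eH eS; lia. Qed.

Lemma jet_softF i e : e \in J i -> e \in S = false.
Proof.
move=> ei; apply/negP => eS; have := rs_partition shape e.
by rewrite (bigD1 i) //= ei eS; lia.
Qed.

Lemma edge_cover e : [|| e \in H, [exists i, e \in J i] | e \in S].
Proof.
have := rs_partition shape e; case: (e \in H) (e \in S) => // -[]; rewrite ?orbT //.
rewrite /= add0n addn0 orbF => s1; apply/existsP; case: (pickP (fun i => e \in J i)) => [i|noj].
  by exists i.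
by move: s1; rewrite big1 // => i _; rewrite noj.
Qed.

Lemma soft_jetF i v : v \in VJ i -> v \in VS = false.
Proof.
rewrite !inE => /andP[/exists_inP[e ei ve] _]; apply/negP => /forallP/(_ e).
by rewrite ve (jet_softF ei).
Qed.

Lemma jet_verts_inj i j v : v \in VJ i -> v \in VJ j -> i = j.
Proof.
rewrite !inE => /andP[/exists_inP[e ei ve] _] /andP[_ /forallP/(_ e)].
by rewrite ve inE (jet_softF ei) orbF => /(jet_inj ei).
Qed.

Lemma hard_jet_vertsF i v : v \in VH -> v \in VJ i = false.
Proof.
rewrite inE [v \in _ :|: _]inE negb_or => /andP[_ h].
by apply: contraNF h => vi; apply/bigcupP; exists i.
Qed.

Lemma hard_soft_vertsF v : v \in VH -> v \in VS = false.
Proof. by rewrite [v \in VH]inE inE negb_or => /andP[/negbTE]. Qed.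

Lemma nonsoft_verts : ~: VS = VH :|: \bigcup_i VJ i.
Proof.
apply/setP=> v; rewrite [RHS]inE [v \in VH]inE [v \in VS :|: _]inE [LHS]inE.
case: (boolP (v \in VS)) => [vS|_] //=; last by rewrite orNb.
by symmetry; apply/negP => /bigcupP[i _ vi]; rewrite (soft_jetF vi) in vS.
Qed.

Lemma ends_H : ends_in g VH H.
Proof.
have end_H e v : e \in H -> incident G e v -> v \in VH.
  move=> eH ev; rewrite inE inE negb_or inE; apply/andP; split.
    by apply/negP => /forallP/(_ e); rewrite ev (hard_softF eH).
  apply/negP => /bigcupP[i _]; rewrite inE => /andP[_ /forallP/(_ e)].
  by rewrite ev inE (hard_softF eH) (hard_jetF _ eH).
by move=> e eH; rewrite !(end_H e) /incident ?eqxx ?orbT.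
Qed.

(** An end of a jet edge is not soft, because it meets a non-soft edge, and not in another jet,
    whose vertices meet only soft edges and edges of that jet. *)
Lemma ends_J i : ends_in g (VJ i :|: VH) (J i).
Proof.
have end_J e v : e \in J i -> incident G e v -> v \in VJ i :|: VH.
  move=> ei ev; rewrite inE orbC inE [v \in VS :|: _]inE.
  case: (boolP (v \in VS)) => [|_] /=.
    by rewrite inE => /forallP/(_ e); rewrite ev (jet_softF ei).
  case: bigcupP => [[k _ vk]|] //=; suff <- : k = i by [].
  move: vk; rewrite inE => /andP[_ /forallP/(_ e)].
  by rewrite ev inE (jet_softF ei) orbF => /jet_inj/(_ ei).
by move=> e eJ; rewrite !(end_J e) /incident ?eqxx ?orbT.
Qed.

Lemma ends_hard_jets (P : pred 'I_K) :
  ends_in g (VH :|: \bigcup_(k | P k) VJ k) (H :|: \bigcup_(k | P k) J k).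
Proof.
apply: ends_inU => [|e /bigcupP[k Pk ek]].
  by apply: ends_inS ends_H => //; apply: subsetUl.
apply: (ends_inS _ _ (@ends_J k)) (ek) => //.
by rewrite setUC setUS //; apply: bigcup_sup.
Qed.

Lemma ends_HJ : ends_in g (~: VS) HJ.
Proof. by rewrite nonsoft_verts; apply: ends_hard_jets. Qed.

Lemma conn_hard : {in VH &, forall v w, conn g H v w}.
Proof.
(* [hard_graph] has the same adjacency as the whole graph by definition, so connectivity needs no
   transport. *)
move=> v w vH wH; apply: (@ncomp1_conn _ _ _ _ (hard_graph G H J S)) => //.
  exact: ends_H.
by rewrite (rs_hard_connected shape).
Qed.

Lemma hard_nonempty : {h0 | h0 \in VH}.
Proof.
apply/sigW/set0Pn/eqP => V0; have := rs_hard_connected shape.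
rewrite /ncomp /hard_graph /= V0 /n_comp_mem => c1.
suff : #|predI (roots (adj (subgraph G set0 H) H)) (mem (set0 : {set V}))| = 0 by rewrite c1.
by apply: eq_card0 => v; rewrite !inE andbF.
Qed.

Lemma conn_hard_jet i : {in VJ i :|: VH &, forall v w, conn g (H :|: J i) v w}.
Proof.
have sH : H \subset H :|: J i := subsetUl _ _.
have sJ : J i \subset H :|: J i := subsetUr _ _.
(* A jet vertex reaches H inside its jet up to an attaching edge, then along that edge. *)
have toH v : v \in VJ i :|: VH -> exists2 h, h \in VH & conn g (H :|: J i) v h.
  rewrite inE => /orP[vi|vH]; last by exists v => //; apply: connect0.
  have J0 : J i != set0.
    by move: vi; rewrite inE => /andP[/exists_inP[e ei _] _]; apply/set0Pn; exists e.
  have [e ei [h hH eh]] := rs_jet_attached shape J0; exists h => //.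
  (* One end of the attaching edge is a jet vertex; h is not, so it is the other end. *)
  have [u ui ue] : exists2 u, u \in VJ i & conn g (J i) u h.
    have hi := hard_jet_vertsF i hH; have st := conn_edge g ei.
    move: (rs_jet_edges shape ei) eh => /orP[] ui /orP[] /eqP eh.
    - by rewrite eh hi in ui.
    - by exists (fg_src G e); rewrite // -eh.
    - by exists (fg_tgt G e); rewrite // -eh conn_sym.
    - by rewrite eh hi in ui.
  apply: conn_trans (conn_sub sJ ue).
  apply: connect_sub (rs_jet_connected shape vi ui) => a b /and3P[_ _ ab].
  by apply/connect1; case/adjP: ab => f fi ?; apply/adjP; exists f; rewrite // inE fi orbT.
move=> v w /toH[h hH vh] /toH[h' hH' wh']; apply: conn_trans vh _.
by rewrite conn_sym; apply: conn_trans wh' _; apply: conn_sub (conn_hard hH' hH).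
Qed.

Lemma conn_hard_jets (P : pred 'I_K) : {in VH :|: \bigcup_(k | P k) VJ k &, forall v w,
  conn g (H :|: \bigcup_(k | P k) J k) v w}.
Proof.
have [h0 hH0] := hard_nonempty.
have toH v : v \in VH :|: \bigcup_(k | P k) VJ k ->
    conn g (H :|: \bigcup_(k | P k) J k) h0 v.
  rewrite inE => /orP[vH|/bigcupP[i Pi vi]].
    by apply: conn_sub (conn_hard hH0 vH); apply: subsetUl.
  apply: conn_sub (conn_hard_jet (_ : h0 \in VJ i :|: VH) (_ : v \in VJ i :|: VH)).
  - exact/setUS/bigcup_sup.
  - by rewrite inE hH0 orbT.
  - by rewrite inE vi.
by move=> v w /toH vh /toH; apply: conn_trans; rewrite conn_sym.
Qed.

Lemma conn_hard_all_jets : {in ~: VS &, forall v w, conn g HJ v w}.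
Proof. by rewrite nonsoft_verts; apply: conn_hard_jets. Qed.

Lemma card_nonsoft : #|~: VS| = #|VH| + \sum_i #|VJ i|.
Proof.
rewrite nonsoft_verts cardsU_disjoint.
  by rewrite card_bigcup_disjoint //; apply: jet_verts_inj.
by apply/pred0P => v /=; apply/andP => -[vH /bigcupP[i _]]; rewrite hard_jet_vertsF.
Qed.

Lemma card_verts : #|V| = #|VH| + \sum_i #|VJ i| + #|VS|.
Proof. by rewrite -(cardsC VS) addnC card_nonsoft. Qed.

Lemma setI_cover T : T = (T :&: H) :|: \bigcup_i (T :&: J i) :|: (T :&: S).
Proof.
apply/setP=> e; rewrite !inE; case: (boolP (e \in T)) => eT /=; last first.
  by rewrite orbF; symmetry; apply/negP => /bigcupP[i _]; rewrite inE (negbTE eT).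
have := edge_cover e; rewrite orbA => /orP[|->]; last by rewrite orbT.
case/orP=> [->//|/existsP[i ei]]; symmetry; rewrite orbAC; apply/orP; right.
by apply/bigcupP; exists i; rewrite // inE eT.
Qed.

Lemma card_cover T : #|T| = #|T :&: H| + \sum_i #|T :&: J i| + #|T :&: S|.
Proof.
rewrite {1}(setI_cover T) cardsU_disjoint; last first.
  apply/pred0P => e /=; rewrite in_setU !in_setI; apply/andP => -[e1 /andP[_ eS]].
  case/orP: e1 => [/andP[_ /hard_softF]|/bigcupP[i _]]; first by rewrite eS.
  by rewrite inE => /andP[_ /jet_softF]; rewrite eS.
rewrite cardsU_disjoint; last first.
  apply/pred0P => e /=; rewrite !inE; apply/andP => -[/andP[_ eH] /bigcupP[i _]].
  by rewrite inE hard_jetF // andbF.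
rewrite card_bigcup_disjoint // => i j e; rewrite !inE => /andP[_ ei] /andP[_].
exact: jet_inj.
Qed.

Lemma setI_HJ T : T :&: HJ = (T :&: H) :|: \bigcup_i (T :&: J i).
Proof. by rewrite setIUr big_distrr. Qed.

Lemma card_HJ T : #|T :&: HJ| = #|T :&: H| + \sum_i #|T :&: J i|.
Proof.
rewrite setI_HJ cardsU_disjoint; last first.
  apply/pred0P => e /=; rewrite !inE; apply/andP => -[/andP[_ eH] /bigcupP[i _]].
  by rewrite inE hard_jetF // andbF.
rewrite card_bigcup_disjoint // => i j e; rewrite !inE => /andP[_ ei] /andP[_].
exact: jet_inj.
Qed.

End Region.

(** * Ranks of the pieces of a region, and numerical criteria for trees *)

Section RegionTrees.
Variables (K M N : nat) (V : finType) (G : feynman_graph K M N V).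
Variables (H : {set 'I_N}) (J : 'I_K -> {set 'I_N}) (S : {set 'I_N}).
Hypothesis shape : region_shape G H J S.
Implicit Types (T X Y F : {set 'I_N}) (W D : {set V}) (e : 'I_N) (v w : V) (i j : 'I_K).
Local Notation g := (whole G).
Local Notation VH := (hard_verts G J S).
Local Notation VJ := (jet_verts G J S).
Local Notation VS := (soft_verts G S).
Local Notation HJ := (H :|: \bigcup_i J i).
Local Notation gT := (erefl : verts g = _).

Lemma ncomp_H : ncomp g H + #|VH| = #|V|.+1.
Proof.
apply: (ncomp_connected gT (ends_H shape)) (conn_hard shape).
by have [h0 hH0] := hard_nonempty shape; apply/set0Pn; exists h0.
Qed.

Lemma ncomp_J i : ncomp g (H :|: J i) + (#|VJ i| + #|VH|) = #|V|.+1.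
Proof.
rewrite -cardsU_disjoint; last first.
  by apply/pred0P => v /=; apply/andP => -[vi /(hard_jet_vertsF i)]; rewrite vi.
have wH : ends_in g (VJ i :|: VH) H.
  by apply: ends_inS (ends_H shape) => //; apply: subsetUr.
apply: (ncomp_connected gT (ends_inU wH (ends_J shape (i := i)))) (conn_hard_jet shape (i := i)).
by have [h0 hH0] := hard_nonempty shape; apply/set0Pn; exists h0; rewrite inE hH0 orbT.
Qed.

Lemma ncomp_HJ : ncomp g HJ = #|VS|.+1.
Proof.
have := ncomp_connected gT (ends_HJ shape) _ (conn_hard_all_jets shape).
have [h0 hH0] := hard_nonempty shape.
have -> : ~: VS != set0 by apply/set0Pn; exists h0; rewrite inE (hard_soft_vertsF hH0).
by have := cardsC VS; move=> ? /(_ isT); nlia.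
Qed.

Lemma ncomp_gt0 T : 0 < ncomp g T.
Proof.
have [h0 hH0] := hard_nonempty shape.
by apply: (@ncomp_pairwise _ _ _ _ g T [:: h0]) => // e; rewrite !inE.
Qed.

(** This and the following criteria reduce each tree condition to two equations, one for components
    and one for edges, that are accessible to linear arithmetic. *)
Lemma whole_treeE k T : spanning_tree g k T = (ncomp g T == k) && (#|T| + k == #|V|).
Proof.
rewrite (spanning_tree_subgraph (W := setT)) => [|e _]; last by rewrite !inE.
by rewrite subsetT setCT cards0 addn0 cardsT.
Qed.

Lemma hard_treeE k T : spanning_tree (hard_graph G H J S) k (T :&: H) =
  (ncomp g (T :&: H) + #|VH| == k + #|V|) && (#|T :&: H| + k == #|VH|).
Proof.
rewrite spanning_tree_subgraph; last by apply: ends_inS (ends_H shape) => //; apply: subsetIr.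
by rewrite subsetIr /= -[#|V|](cardsC VH) addnCA [#|VH| + _]addnC eqn_add2r.
Qed.

Lemma hard_jet_treeE k T : spanning_tree (hard_jet_graph G H J S) k (T :&: HJ) =
  (ncomp g (T :&: HJ) == k + #|VS|) && (#|T :&: HJ| + k + #|VS| == #|V|).
Proof.
rewrite spanning_tree_subgraph; last first.
  rewrite -(nonsoft_verts shape).
  by apply: ends_inS (ends_HJ shape) => //; apply: subsetIr.
rewrite -(nonsoft_verts shape) setCK subsetIr /= -[#|V|](cardsC VS) [#|VS| + _]addnC.
by rewrite eqn_add2r.
Qed.

Lemma jet_treeE i k T : spanning_tree (jet_tilde G J S i) k (T :&: J i) =
  (ncomp g (T :&: J i :|: H) + (#|VJ i| + #|VH|) == k + #|V|)
  && (#|T :&: J i| + k == #|VJ i|.+1).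
Proof.
have [h0 hH0] := hard_nonempty shape.
have dis : [disjoint VJ i & VH].
  by apply/pred0P => v /=; apply/andP => -[vi /(hard_jet_vertsF i)]; rewrite vi.
rewrite (spanning_tree_contracted _ hH0 dis (ends_H shape) (conn_hard shape)).
  rewrite subsetIr /= -[#|V|](cardsC (VJ i :|: VH)) (cardsU_disjoint dis).
  by rewrite [k + (_ + _)]addnCA [ncomp g _ + _]addnC eqn_add2l.
by apply: ends_inS (ends_J shape (i := i)) => //; apply: subsetIr.
Qed.

Lemma soft_contr : exists2 d, d \in ~: VS & [disjoint VS & ~: VS].
Proof.
have [h0 hH0] := hard_nonempty shape; exists h0.
  by rewrite inE (hard_soft_vertsF hH0).
by rewrite -setI_eq0 setICr.
Qed.

Lemma soft_treeE k T : spanning_tree (soft_tilde G S) k (T :&: S) =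
  (ncomp g (T :&: S :|: HJ) == k) && (#|T :&: S| + k == #|VS|.+1).
Proof.
have [d dS dis] := soft_contr.
rewrite (spanning_tree_contracted _ dS dis (ends_HJ shape) (conn_hard_all_jets shape)).
  by rewrite subsetIr setUCr setCT cards0 addn0.
by rewrite setUCr => e _; rewrite !inE.
Qed.

Lemma soft_loopsE T : loops (soft_tilde G S) (T :&: S) + #|VS|.+1 =
  #|T :&: S| + ncomp g (T :&: S :|: HJ).
Proof.
have [d dS dis] := soft_contr.
have := loops_contracted S dS dis (ends_HJ shape) (conn_hard_all_jets shape) (T := T :&: S).
rewrite setUCr setCT cards0 addn0 => -> // e _; by rewrite !inE.
Qed.

Lemma jjs_compl i j : i != j ->
  ~: (VJ i :|: VJ j :|: VS) = VH :|: \bigcup_(k | (k != i) && (k != j)) VJ k.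
Proof.
move=> nij; apply/setP => v; rewrite in_setC !in_setU.
case: (boolP (v \in VH)) => [vH|vH].
  by rewrite !(hard_jet_vertsF _ vH) (hard_soft_vertsF vH).
case: (boolP (v \in VS)) => [vS|vS] /=.
  rewrite orbT; symmetry; apply/negP => /bigcupP[k _ vk].
  by rewrite (soft_jetF shape vk) in vS.
have : v \in ~: VS by rewrite inE.
rewrite (nonsoft_verts shape) inE (negbTE vH) => /bigcupP[l _ vl].
apply/idP/bigcupP => [|[k /andP[ki kj] vk]].
  rewrite orbF negb_or => /andP[ni nj]; exists l => //.
  by apply/andP; split; apply/eqP => le; [case/negP: ni | case/negP: nj]; rewrite -le.
by rewrite orbF; apply/norP; split; apply/negP => vi; [case/eqP: ki|case/eqP: kj];
  apply: (jet_verts_inj shape) vk vi.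
Qed.

Lemma jjs_contr i j : i != j -> let D := ~: (VJ i :|: VJ j :|: VS) in
  let X := H :|: \bigcup_(k | (k != i) && (k != j)) J k in
  [/\ exists d, d \in D, [disjoint VJ i :|: VJ j :|: VS & D], ends_in g D X
    & {in D &, forall v w, conn g X v w}].
Proof.
move=> nij D X; rewrite /D jjs_compl //; split.
- by have [h0 hH0] := hard_nonempty shape; exists h0; rewrite inE hH0.
- by rewrite -jjs_compl // -setI_eq0 setICr.
- exact: ends_hard_jets.
- exact: conn_hard_jets.
Qed.

Lemma jjs_treeE i j k T : i != j ->
  spanning_tree (jet_jet_soft G J S i j) k (T :&: (J i :|: J j :|: S)) =
  (ncomp g (T :&: (J i :|: J j :|: S) :|: (H :|: \bigcup_(k | (k != i) && (k != j)) J k)) == k)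
  && (#|T :&: (J i :|: J j :|: S)| + k == (#|VJ i| + #|VJ j| + #|VS|).+1).
Proof.
move=> nij; have [[d dD] dis wX cX] := jjs_contr nij.
rewrite (spanning_tree_contracted _ dD dis wX cX).
  rewrite subsetIr setUCr setCT cards0 addn0 !cardsU_disjoint //.
    apply/pred0P => v /=; apply/andP => -[vi vj].
    by rewrite (jet_verts_inj shape vi vj) eqxx in nij.
  apply/pred0P => v /=; rewrite in_setU; apply/andP => -[/orP[] vi vS];
    by rewrite (soft_jetF shape vi) in vS.
by rewrite setUCr => e _; rewrite !inE.
Qed.

End RegionTrees.

Lemma sum_mem_card (I : finType) (A : {set I}) : \sum_i (i \in A) = #|A|.
Proof. by rewrite -sum1_card [RHS]big_mkcond /=; apply: eq_bigr => i _; case: (i \in A). Qed.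

(** * Leading spanning trees and 2-trees *)

(** Localises equality in an estimate summed over the jets to each single jet. *)
Lemma eq_of_leq_sum (I : finType) (a b : I -> nat) :
  (forall i, a i <= b i) -> \sum_i b i <= \sum_i a i -> forall i, a i = b i.
Proof.
move=> ab; have [le eq_iff] := leqif_sum (fun i (_ : true) => leqif_eq (ab i)).
move=> le' i; apply/eqP; move: eq_iff; rewrite eqn_leq le le' => /esym/forallP/(_ i).
by [].
Qed.

Section LeadingForests.
Variables (K M N : nat) (V : finType) (G : feynman_graph K M N V).
Variables (H : {set 'I_N}) (J : 'I_K -> {set 'I_N}) (S : {set 'I_N}).
Hypothesis shape : region_shape G H J S.
Implicit Types (T X Y F : {set 'I_N}) (W D : {set V}) (e : 'I_N) (v w : V) (i j : 'I_K).
Local Notation g := (whole G).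
Local Notation VH := (hard_verts G J S).
Local Notation VJ := (jet_verts G J S).
Local Notation VS := (soft_verts G S).
Local Notation HJ := (H :|: \bigcup_i J i).
Local Notation gT := (erefl : verts g = _).
Local Notation treeH k T := (spanning_tree (hard_graph G H J S) k (T :&: H)).
Local Notation treeHJ k T := (spanning_tree (hard_jet_graph G H J S) k (T :&: HJ)).
Local Notation treeJ i k T := (spanning_tree (jet_tilde G J S i) k (T :&: J i)).
Local Notation treeS k T := (spanning_tree (soft_tilde G S) k (T :&: S)).

(* Minus the normal vector of the region, summed over the edges of T. *)
Definition weight T := \sum_i #|T :&: J i| + 2 * #|T :&: S|.
(** Spanning trees of \tilde J_i and \tilde S, which have one auxiliary vertex each, have as many
    edges as J_i and S have vertices. *)
Definition min_weight := \sum_i #|VJ i| + 2 * #|VS|.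

(** An edge weighs one for not being in H and one more for not being in HJ. *)
Lemma weightE T : weight T + #|T :&: HJ| + #|T :&: H| = 2 * #|T|.
Proof. by rewrite (card_HJ shape) (card_cover shape T) /weight; nlia. Qed.

Lemma min_weightE : min_weight + #|VH| = #|V| + #|VS|.
Proof. by rewrite (card_verts shape) /min_weight; nlia. Qed.

Definition spansb T X := [forall e in X, conn g T (src g e) (tgt g e)].

Lemma spansP T X : reflect (spans g T X) (spansb T X).
Proof. exact: forall_inP. Qed.

Lemma forestE T k : ncomp g T = k -> #|T| + k = #|V| -> forest g T.
Proof. by rewrite /forest => -> ->. Qed.

Lemma forestI T X : forest g T -> #|T :&: X| + ncomp g (T :&: X) = #|V|.
Proof. by move=> fT; apply/eqP/(forestS gT (subsetIl T X)). Qed.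

Lemma forest_bound T X : forest g T -> #|T :&: X| + ncomp g X <= #|V|.
Proof.
move=> fT; rewrite -(forestI X fT) leq_add2l.
by apply: (ncomp_mono gT); apply: subsetIr.
Qed.

(** If the trace of T on X had the full rank of X, the trace, and hence T, would span X. *)
Lemma forest_bound_lt T X : forest g T -> ~~ spansb T X ->
  #|T :&: X| + ncomp g X < #|V|.
Proof.
move=> fT nTX; rewrite -(forestI X fT) ltn_add2l ltnNge; apply: contra nTX => le.
apply/spansP; apply: spans_trans (ncomp_spans gT (subsetIr T X) le).
by apply: subset_spans; apply: subsetIl.
Qed.

Lemma att_nonsoft l : fg_att G l \in ~: VS.
Proof. by rewrite inE (rs_soft_noext shape). Qed.

Lemma att_hard_or_jet l : fg_att G l \in VH \/ exists2 i, l = inl i & fg_att G l \in VJ i.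
Proof.
case: l => [i|q]; last by left; apply: (rs_q_hard shape).
by have := rs_p_jet shape i; case: ifP => _; [left|right; exists i].
Qed.

(* If T spans H, these are the jets with a vertex on the side of the cut away from H. *)
Definition jets_cut T := [set i | ~~ spansb T (J i)].

Lemma ncomp_jet_ge T i : #|V| < ncomp g (T :&: J i :|: H) + (#|VJ i| + #|VH|).
Proof.
rewrite -(ncomp_J shape i) leq_add2r; apply: (ncomp_mono gT).
by rewrite setUC setUS // subsetIr.
Qed.

(** Without the extra component, the trace on the jet together with H would span the jet; as T spans
    H, so would T. *)
Lemma ncomp_jet_cut T i : spans g T H ->
  #|V| + (i \in jets_cut T) < ncomp g (T :&: J i :|: H) + (#|VJ i| + #|VH|).
Proof.
move=> TH; case: (boolP (i \in _)) => [|_]; last by rewrite addn0 ncomp_jet_ge.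
rewrite inE addn1 -(ncomp_J shape i) ltn_add2r ltnNge; apply: contra => le.
have sub : T :&: J i :|: H \subset H :|: J i by rewrite setUC setUS // subsetIr.
apply/spansP => e ei; have := ncomp_spans gT sub le; move/(_ e).
rewrite inE ei orbT => /(_ isT); apply: spans_conn; apply: spansU => //.
by apply: subset_spans; apply: subsetIl.
Qed.

(* Submodularity, the jets being attached to H one after the other. *)
Lemma ncomp_union_jets (s : seq 'I_K) T :
  ncomp g H + \sum_(k <- s) ncomp g (T :&: J k :|: H) <=
  ncomp g (H :|: \bigcup_(k <- s) (T :&: J k)) + size s * ncomp g H.
Proof.
elim: s => [|k s IH] /=; first by rewrite !big_nil setU0 addn0.
rewrite !big_cons [_ :|: \bigcup_(_ <- _) _]setUC setUA [T :&: J k :|: H]setUC.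
have := ncomp_submod gT (T :&: J k) (subsetUl H (\bigcup_(k <- s) (T :&: J k))).
by rewrite mulSn; nlia.
Qed.

Lemma card_HJ_cut T : forest g T -> spans g T H ->
  #|T :&: HJ| + #|VS|.+1 + #|jets_cut T| <= #|V|.
Proof.
move=> fT TH; have := ncomp_union_jets (index_enum _) T.
have -> : size (index_enum 'I_K) = K by rewrite -[RHS]card_ord cardT enumT.
set Z := (X in _ <= ncomp g X + _) => leZ.
(* Z is the trace on HJ enlarged by all of H, so a lower bound on its components is enough. *)
have leY : ncomp g Z <= ncomp g (T :&: HJ).
  by apply: (ncomp_mono gT); rewrite (setI_HJ H J T) setSU // subsetIr.
have := forestI HJ fT; have := ncomp_H shape; have := card_verts shape.
have : \sum_(i < K) (#|V|.+1 + (i \in jets_cut T)) <=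
    \sum_i ncomp g (T :&: J i :|: H) + \sum_i (#|VJ i| + #|VH|).
  by rewrite -big_split; apply: leq_sum => i _; apply: ncomp_jet_cut.
have -> : \sum_(i < K) (#|V|.+1 + (i \in jets_cut T)) = K * #|V|.+1 + #|jets_cut T|.
  by rewrite big_split /= sum_nat_const card_ord sum_mem_card.
have -> : \sum_i (#|VJ i| + #|VH|) = \sum_i #|VJ i| + K * #|VH|.
  by rewrite big_split /= sum_nat_const card_ord.
move=> leJ cV cH fY.
(* The product with K has to be formed by hand before linear arithmetic can cancel it. *)
have : K * ncomp g H + K * #|VH| = K * #|V|.+1 by rewrite -mulnDr cH.
by nlia.
Qed.

Lemma forest_hard_tree T k : forest g T -> #|T :&: H| + k = #|VH| -> treeH k T.
Proof.
move=> fT TH; rewrite (hard_treeE shape) TH eqxx andbT.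
by apply/eqP; have := forestI H fT; nlia.
Qed.

Lemma hard_tree_spans T : treeH 1 T -> spans g (T :&: H) H.
Proof.
rewrite (hard_treeE shape) => /andP[/eqP cT _].
by apply: (ncomp_spans gT) (subsetIr _ _) _; have := ncomp_H shape; nlia.
Qed.

Lemma hard_tree_spansT T : treeH 1 T -> spans g T H.
Proof. by move/hard_tree_spans; apply/spans_trans/subset_spans/subsetIl. Qed.

(** As the trace on H spans H, it may replace H; what remains is the trace of a forest, hence a
    forest. *)
Lemma forest_jet T i : forest g T -> spans g (T :&: H) H ->
  #|T :&: J i| + #|T :&: H| + ncomp g (T :&: J i :|: H) = #|V|.
Proof.
move=> fT TH.
have -> : ncomp g (T :&: J i :|: H) = ncomp g (T :&: J i :|: T :&: H).
  apply: spans_ncomp; first by apply: subset_spans; rewrite setUS // subsetIr.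
  apply: spansU; first exact/subset_spans/subsetUl.
  by apply: spans_trans TH; apply/subset_spans/subsetUr.
rewrite -setIUr -(forestI (J i :|: H) fT) setIUr cardsU_disjoint //.
apply/pred0P => e /=; rewrite !inE; apply/andP => -[/andP[_ ei] /andP[_ eH]].
by rewrite (hard_jetF shape) in ei.
Qed.

Lemma forest_jet_tree T i k : forest g T -> treeH 1 T ->
  #|T :&: J i| + k = #|VJ i|.+1 -> treeJ i k T.
Proof.
move=> fT tH Ti; rewrite (jet_treeE shape) Ti eqxx andbT; apply/eqP.
have := forest_jet i fT (hard_tree_spans tH).
by move: tH; rewrite (hard_treeE shape) => /andP[_ /eqP]; nlia.
Qed.

Lemma forest_jet_le T i : forest g T -> treeH 1 T -> #|T :&: J i| <= #|VJ i|.
Proof.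
move=> fT tH; have := forest_jet i fT (hard_tree_spans tH).
have := ncomp_jet_ge T i.
by move: tH; rewrite (hard_treeE shape) => /andP[_ /eqP]; nlia.
Qed.

(** Equality in [card_HJ_cut] forces equality jet by jet. The number of components encodes the
    outcome: 2 for a cut jet, 1 for any other. *)
Lemma forest_jet_trees T : forest g T -> treeH 1 T ->
  #|T :&: HJ| + #|VS|.+1 + #|jets_cut T| = #|V| ->
  forall i, treeJ i (i \in jets_cut T).+1 T.
Proof.
move=> fT tH TY i; apply: forest_jet_tree => //.
suff : #|T :&: J i| + (i \in jets_cut T) = #|VJ i| by nlia.
move: i; apply: eq_of_leq_sum => [i|].
  have := forest_jet i fT (hard_tree_spans tH).
  have := ncomp_jet_cut i (hard_tree_spansT tH).
  by move: tH; rewrite (hard_treeE shape) => /andP[_ /eqP]; nlia.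
rewrite big_split /=.
rewrite sum_mem_card.
have := card_HJ shape T; have := card_verts shape.
by move: tH; rewrite (hard_treeE shape) => /andP[_ /eqP]; nlia.
Qed.

Lemma setU_soft_HJ T : T :&: S :|: HJ = T :|: HJ.
Proof.
apply/setP => e; rewrite !in_setU in_setI; case: (boolP (e \in T)) => //= _.
have := edge_cover shape e; case: (e \in H) => //=; case: (e \in S) => //=; rewrite orbF.
by case/existsP=> i ei; apply/bigcupP; exists i.
Qed.

(** If adding HJ did not merge the two components, T would already span HJ. *)
Lemma two_tree_cut T : ncomp g T = 2 -> ~~ spansb T HJ -> ncomp g (T :|: HJ) = 1.
Proof.
move=> cT nT; apply/eqP; rewrite eqn_leq (ncomp_gt0 shape) andbT leqNgt; apply: contra nT.
move=> c2; apply/spansP; apply: spans_trans (ncomp_spans gT (subsetUl T HJ) _) _.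
  by rewrite cT.
exact/subset_spans/subsetUr.
Qed.

Lemma hard_tree_card T k : treeH k T -> #|T :&: H| + k = #|VH|.
Proof. by rewrite hard_treeE // => /andP[_ /eqP]. Qed.

Lemma jet_tree_card T i k : treeJ i k T -> #|T :&: J i| + k = #|VJ i|.+1.
Proof. by rewrite (jet_treeE shape) => /andP[_ /eqP]. Qed.

Lemma soft_tree_card T k : treeS k T -> #|T :&: S| + k = #|VS|.+1.
Proof. by rewrite (soft_treeE shape) => /andP[_ /eqP]. Qed.

Lemma soft_tree_ncomp T k : treeS k T -> ncomp g (T :|: HJ) = k.
Proof. by rewrite (soft_treeE shape) setU_soft_HJ => /andP[/eqP]. Qed.

Lemma hard_jet_tree_card T k : treeHJ k T -> #|T :&: HJ| + k + #|VS| = #|V|.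
Proof. by rewrite (hard_jet_treeE shape) => /andP[_ /eqP]. Qed.

Lemma hard_jet_tree_ncomp T k : treeHJ k T -> ncomp g (T :&: HJ) = k + #|VS|.
Proof. by rewrite (hard_jet_treeE shape) => /andP[/eqP]. Qed.

Lemma jet_tree_spansUH T i : treeJ i 1 T -> spans g (T :&: J i :|: H) (J i).
Proof.
rewrite (jet_treeE shape) => /andP[/eqP cT _].
have sub : T :&: J i :|: H \subset H :|: J i by rewrite setUC setUS // subsetIr.
have le : ncomp g (T :&: J i :|: H) <= ncomp g (H :|: J i).
  by have := ncomp_J shape i; nlia.
by move=> e ei; apply: (ncomp_spans gT sub le); rewrite inE ei orbT.
Qed.

Lemma jet_tree_spans T i : treeH 1 T -> treeJ i 1 T -> spans g T (J i).
Proof.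
move=> tH /jet_tree_spansUH; apply: spans_trans; apply: spansU.
  by apply: subset_spans; apply: subsetIl.
exact: hard_tree_spansT.
Qed.

Lemma trees_spans T (P : pred 'I_K) : treeH 1 T -> (forall i, P i -> treeJ i 1 T) ->
  spans g T (H :|: \bigcup_(i | P i) J i).
Proof.
move=> tH tJ; apply: spansU; first exact: hard_tree_spansT.
by move=> e /bigcupP[i Pi]; apply: jet_tree_spans; rewrite ?tJ.
Qed.

(** Forwards, least weight makes the bounds on the traces on H and on HJ equalities, and
    connectedness of T leaves no jet cut. Backwards, the traces make T span HJ, so that T has as
    many components as [T :|: HJ]. *)
Lemma leading_tree T : spanning_tree g 1 T && (weight T <= min_weight) =
  [&& treeH 1 T, [forall i, treeJ i 1 T] & treeS 1 T].
Proof.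
apply/idP/idP.
  rewrite whole_treeE => /andP[/andP[/eqP cT /eqP nT] w].
  have fT := forestE cT nT.
  have bH := forest_bound H fT; have bY := forest_bound HJ fT.
  have := ncomp_H shape; have := ncomp_HJ shape; have := weightE T.
  have := min_weightE; move=> e1 e2 e3 e4.
  have eH : #|T :&: H| + 1 = #|VH| by nlia.
  have tH := forest_hard_tree fT eH; rewrite tH /=.
  have connT v w' : conn g T v w'.
    by apply: ncomp1_conn; rewrite ?cT ?inE // => e _; rewrite !inE.
  have cut0 : jets_cut T = set0.
    by apply/setP=> i; rewrite !inE; apply/negbF/spansP => e _.
  have tJ i : treeJ i 1 T.
    have := forest_jet_trees fT tH _ i; rewrite cut0 cards0 inE; apply.
    by nlia.
  apply/andP; split; first exact/forallP.
  rewrite (soft_treeE shape) setU_soft_HJ; apply/andP; split.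
    by rewrite eqn_leq (ncomp_gt0 shape) -cT (ncomp_mono gT) // subsetUl.
  by have := card_HJ shape T; have := card_cover shape T; nlia.
case/and3P=> tH /forallP tJ tS.
have TH : spans g T HJ by apply: trees_spans.
have eJ : \sum_i #|T :&: J i| = \sum_i #|VJ i|.
  by apply: eq_bigr => i _; have := jet_tree_card (tJ i); nlia.
have nT : #|T| + 1 = #|V|.
  have := card_cover shape T; have := card_verts shape.
  by have := hard_tree_card tH; have := soft_tree_card tS; nlia.
rewrite whole_treeE nT eqxx andbT; apply/andP; split.
  rewrite -(soft_tree_ncomp tS); apply/eqP/spans_ncomp; last exact/subset_spans/subsetUl.
  by apply: spansU => //; apply: subset_spans.
have := weightE T; have := min_weightE; have := card_HJ shape T; have := card_verts shape.
by have := hard_tree_card tH; have := soft_tree_card tS; nlia.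
Qed.

(** Compared with a tree, 2|T| drops by 2; but a 2-tree that does not span H spans neither H nor HJ,
    so each of the two traces loses an edge as well. *)
Lemma weight_ge_hard_cut T : ncomp g T = 2 -> #|T| + 2 = #|V| -> ~~ spansb T H ->
  [/\ #|T :&: H| + 2 <= #|VH|, #|T :&: HJ| + 2 + #|VS| <= #|V|
    & min_weight <= weight T].
Proof.
move=> cT nT nH; have fT := forestE cT nT.
have nHJ : ~~ spansb T HJ.
  by apply: contra nH => /spansP TH; apply/spansP => e eH; apply: TH; rewrite inE eH.
have := forest_bound_lt fT nH; have := forest_bound_lt fT nHJ.
have := ncomp_H shape; have := ncomp_HJ shape; have := weightE T; have := min_weightE.
by move=> *; split; nlia.
Qed.

(** The same drop of 2 is now compensated only by the trace on HJ, which loses one edge for every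
    cut jet. *)
Lemma weight_ge_jets_cut T : ncomp g T = 2 -> #|T| + 2 = #|V| -> spansb T H ->
  min_weight + #|jets_cut T| <= weight T + 2.
Proof.
move=> cT nT /spansP TH; have fT := forestE cT nT.
have := card_HJ_cut fT TH; have := forest_bound H fT.
have := ncomp_H shape; have := weightE T; have := min_weightE.
by move=> *; nlia.
Qed.

(** The equality case. With m cut jets the soft trace has |VS| - 1 + m edges and is connected once
    HJ is contracted: a spanning tree of \tilde S for m = 1, one loop for m = 2. *)
Lemma leading_jets_cut T : ncomp g T = 2 -> #|T| + 2 = #|V| -> spansb T H ->
  ~~ spansb T HJ -> weight T + 2 <= min_weight + #|jets_cut T| ->
  [/\ treeH 1 T, forall i, treeJ i (i \in jets_cut T).+1 T,
      #|T :&: S| + 1 = #|VS| + #|jets_cut T| & ncomp g (T :&: S :|: HJ) = 1].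
Proof.
move=> cT nT /spansP TH nHJ le; have fT := forestE cT nT.
have := card_HJ_cut fT TH; have := forest_bound H fT.
have := ncomp_H shape; have := weightE T; have := min_weightE.
have cHJ := card_HJ shape T; have cc := card_cover shape T.
move=> e1 e2 e3 e4 e5.
have tH : treeH 1 T by apply: forest_hard_tree => //; nlia.
split=> //; last by rewrite setU_soft_HJ two_tree_cut.
  by apply: forest_jet_trees => //; nlia.
by nlia.
Qed.

(** A second leg is needed so that the empty set is not the complement of {p_i}. *)
Lemma p_cut_sub i (A : {set leg K M}) : 1 < #|leg K M| -> A \subset [set inl i] ->
  p_cut i A = (inl i \in A).
Proof.
move=> legs2; rewrite subset1 => /orP[]/eqP->; first by rewrite /p_cut /splits eqxx set11.
rewrite /p_cut /splits in_set0 setC0; apply/norP; split; apply/eqP.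
  by move/setP/(_ (inl i)); rewrite !inE eqxx.
by move=> eT; move: legs2; rewrite -cardsT eT cards1.
Qed.

Lemma keep_hard i v : v \in VH -> keep (VJ i) v = None.
Proof. by move=> vH; rewrite keep_out // hard_jet_vertsF. Qed.

Lemma p_cut_neq0 i (A : {set leg K M}) : 1 < #|leg K M| -> p_cut i A -> A != set0.
Proof.
move=> legs2; apply: contraL => /eqP->; rewrite p_cut_sub ?sub0set //.
by rewrite inE.
Qed.

Section Far.
Variable h0 : V.
Hypothesis hH0 : h0 \in VH.

Lemma spans_hard_verts T : spans g T H -> {in VH, forall v, conn g T h0 v}.
Proof. by move=> TH v vH; apply: spans_conn TH (conn_hard shape hH0 vH). Qed.

Lemma spans_jet_verts T i : spans g T H -> spans g T (J i) ->
  {in VJ i, forall v, conn g T h0 v}.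
Proof.
move=> TH TJ v vi; apply: spans_conn (spansU TH TJ) _.
by apply: (conn_hard_jet shape); rewrite inE ?vi ?hH0 ?orbT.
Qed.

Lemma spans_nonsoft_verts T : spans g T HJ -> {in ~: VS, forall v, conn g T h0 v}.
Proof.
move=> TH v vS; apply: spans_conn TH (conn_hard_all_jets shape _ vS).
by rewrite inE (hard_soft_vertsF hH0).
Qed.

Lemma spans_far T : spans g T HJ -> far g T h0 = set0.
Proof.
move=> TH; apply/setP=> l; rewrite !inE.
by rewrite (spans_nonsoft_verts TH (att_nonsoft l)).
Qed.

Lemma conn_spans_HJ T : {in ~: VS, forall v, conn g T h0 v} -> spans g T HJ.
Proof.
move=> cT e /(ends_HJ shape)/andP[sV tV]; apply: conn_trans (cT _ tV).
by rewrite conn_sym; apply: cT.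
Qed.

Lemma far_jets_cut T l : spans g T H -> l \in far g T h0 ->
  exists2 i, l = inl i & i \in jets_cut T.
Proof.
move=> TH; rewrite inE => nl; case: (att_hard_or_jet l) => [lH|[i li lJ]].
  by rewrite (spans_hard_verts TH lH) in nl.
exists i => //; rewrite inE; apply: contra nl => /spansP TJ.
exact: (spans_jet_verts TH TJ).
Qed.

Lemma conn_jet T i v w : v \in VJ i :|: VH -> w \in VJ i :|: VH ->
  conn (jet_tilde G J S i) (T :&: J i) (keep (VJ i) v) (keep (VJ i) w) =
  conn g (T :&: J i :|: H) v w.
Proof.
have dis : [disjoint VJ i & VH].
  by apply/pred0P => u /=; apply/andP => -[ui /(hard_jet_vertsF i)]; rewrite ui.
apply: (conn_contracted _ hH0 dis (ends_H shape) (conn_hard shape)).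
by apply: ends_inS (ends_J shape (i := i)) => //; apply: subsetIr.
Qed.

(** All legs other than p_i enter \tilde J_i at the auxiliary vertex, so only p_i can be cut off
    from it. *)
Lemma far_jet T i l : (l \in far (jet_tilde G J S i) (T :&: J i) None) =
  (l == inl i) && ~~ conn g (T :&: J i :|: H) h0 (fg_att G l).
Proof.
rewrite inE /=; have hU : h0 \in VJ i :|: VH by rewrite inE hH0 orbT.
have [/eqP->|nl] := boolP (l == inl i).
  rewrite -(conn_jet _ hU) ?(keep_hard _ hH0) //.
  case: (att_hard_or_jet (inl i)) => [lH|[k [<-] lk]]; first by rewrite in_setU lH orbT.
  by rewrite in_setU lk.
suff -> : keep (VJ i) (fg_att G l) = None by rewrite /conn connect0.
case: (att_hard_or_jet l) => [/keep_hard//|[k lk kJ]].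
apply: keep_out; apply: contra nl => li.
by rewrite lk (jet_verts_inj shape kJ li).
Qed.

Lemma far_jet_sub T i : far (jet_tilde G J S i) (T :&: J i) None \subset [set inl i].
Proof. by apply/subsetP => l; rewrite far_jet inE => /andP[]. Qed.

Lemma far_jets_cut_sub T : spansb T H ->
  far g T h0 \subset [set inl i | i in jets_cut T].
Proof.
move=> /spansP TH; apply/subsetP => l /(far_jets_cut TH)[i -> iT].
by apply: imset_f.
Qed.

Lemma far_spans T : far g T h0 != set0 -> ~~ spansb T HJ.
Proof. by apply: contra => /spansP/spans_far->. Qed.

End Far.
End LeadingForests.

(** * The three types of leading 2-trees, characterised by their traces *)

Section LeadingTwoTrees.
Variables (K M N : nat) (V : finType) (G : feynman_graph K M N V).
Variables (H : {set 'I_N}) (J : 'I_K -> {set 'I_N}) (S : {set 'I_N}).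
Hypothesis shape : region_shape G H J S.
Implicit Types (T X Y F : {set 'I_N}) (W D : {set V}) (e : 'I_N) (v w : V) (i j : 'I_K).
Implicit Types (A : {set leg K M}).
Local Notation g := (whole G).
Local Notation VH := (hard_verts G J S).
Local Notation VJ := (jet_verts G J S).
Local Notation VS := (soft_verts G S).
Local Notation HJ := (H :|: \bigcup_i J i).
Local Notation gT := (erefl : verts g = _).
Local Notation treeH k T := (spanning_tree (hard_graph G H J S) k (T :&: H)).
Local Notation treeHJ k T := (spanning_tree (hard_jet_graph G H J S) k (T :&: HJ)).
Local Notation treeJ i k T := (spanning_tree (jet_tilde G J S i) k (T :&: J i)).
Local Notation treeS k T := (spanning_tree (soft_tilde G S) k (T :&: S)).
Local Notation jjs i j := (J i :|: J j :|: S).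
Local Notation treeJJS i j k T := (spanning_tree (jet_jet_soft G J S i j) k (T :&: jjs i j)).
Local Notation w0 := (min_weight G J S).
Local Notation weight := (weight J S).
Variable h0 : V.
Hypothesis hH0 : h0 \in VH.
Local Notation farT T := (far g T h0).

Lemma HJ_setI T : T :&: HJ :|: HJ = HJ.
Proof. by apply/setUidPr/subsetIr. Qed.

(** Reassembles a 2-tree from its traces. By submodularity, adding HJ merges no more in T than in
    the trace of T on HJ, where it removes at most one component. *)
Lemma ncomp_le2 T : ncomp g (T :&: HJ) <= 2 + #|VS| -> ncomp g (T :|: HJ) = 1 ->
  ncomp g T <= 2.
Proof.
move=> cY cT; have := ncomp_submod gT HJ (subsetIl T HJ).
by rewrite HJ_setI cT (ncomp_HJ shape); nlia.
Qed.

Lemma ncomp2 T : #|T| + 2 = #|V| -> ncomp g T <= 2 -> ncomp g T = 2.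
Proof. by move=> nT cT; have := forest_ge gT T; nlia. Qed.

(** The soft edges of T do not rejoin the two parts of its trace: otherwise T would span HJ, and
    [T :|: HJ] would still have two components. *)
Lemma far_HJ T : ncomp g T = 2 -> treeHJ 2 T -> ncomp g (T :|: HJ) = 1 ->
  far (hard_jet_graph G H J S) (T :&: HJ) h0 = farT T.
Proof.
move=> cT /andP[_ /andP[/eqP cY _]] cTHJ.
have sY : T :&: HJ \subset T by apply: subsetIl.
suff hE v : v \in ~: VS -> conn g (T :&: HJ) h0 v = conn g T h0 v.
  by apply/setP => l; rewrite !inE -(hE _ (att_nonsoft shape l)).
move=> vS; apply/idP/idP => [|hv]; first exact: conn_sub.
apply/negPn/negP => nhv; move: cTHJ.
have TH : spans g T HJ.
  apply: (conn_spans_HJ shape) => u uS; have [hu|nhu] := boolP (conn g (T :&: HJ) h0 u).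
    exact: conn_sub hu.
  apply: conn_trans hv _; apply: conn_sub sY _.
  have wY : ends_in (hard_jet_graph G H J S) (verts (hard_jet_graph G H J S)) (T :&: HJ).
    rewrite /= -(nonsoft_verts shape); apply: ends_inS (ends_HJ shape) => //.
    exact: subsetIr.
  have c2 : ncomp (hard_jet_graph G H J S) (T :&: HJ) <= 2 by rewrite cY.
  have H2 := @ncomp2_conn _ _ _ _ _ _ h0 v u wY c2.
  rewrite /= -(nonsoft_verts shape) in H2.
  have hS : h0 \in ~: VS by rewrite inE (hard_soft_vertsF hH0).
  exact: H2 hS vS uS nhv nhu.
have -> : ncomp g (T :|: HJ) = ncomp g T; last by rewrite cT.
apply: spans_ncomp; first exact/subset_spans/subsetUl.
by apply: spansU => //; apply: subset_spans.
Qed.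

Lemma off_shell_neq0 A : off_shell A -> A != set0.
Proof. by case/andP=> /norP[]. Qed.

(** An off-shell cut carries no factor lambda. With the trace on H known, the weight bounds the
    trace on HJ from below and [forest_bound_lt] bounds it from above by the same number; the soft
    trace is then a tree by counting. *)
Lemma leading_hard_cut T : [&& spanning_tree g 2 T, weight T + on_shell (farT T) <= w0,
    off_shell (farT T) & treeH 2 T] =
  [&& treeHJ 2 T, off_shell (far (hard_jet_graph G H J S) (T :&: HJ) h0),
    treeH 2 T & treeS 1 T].
Proof.
have cards := card_cover shape T; have cardY := card_HJ shape T.
have cardV := card_verts shape; have we := weightE shape T; have we0 := min_weightE shape.
apply/idP/idP.
  rewrite whole_treeE => /and4P[/andP[/eqP cT /eqP nT] le off tH].
  have nHJ : ~~ spansb G T HJ by apply: (far_spans shape hH0); apply: off_shell_neq0.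
  have fT := forestE cT nT; have := forest_bound_lt fT nHJ.
  rewrite (ncomp_HJ shape) => bY; have tHc := hard_tree_card shape tH.
  have eY : #|T :&: HJ| + 2 + #|VS| = #|V| by nlia.
  have tY : treeHJ 2 T.
    rewrite (hard_jet_treeE shape) eY eqxx andbT.
    by have := forestI HJ fT => fY; apply/eqP; nlia.
  have cTHJ := two_tree_cut shape cT nHJ.
  rewrite tY tH far_HJ // off (soft_treeE shape) (setU_soft_HJ shape) cTHJ eqxx /=.
  by nlia.
case/and4P=> tY off tH tS.
have cY := hard_jet_tree_ncomp shape tY; have nY := hard_jet_tree_card shape tY.
have nS := soft_tree_card shape tS; have cTHJ := soft_tree_ncomp shape tS.
have tHc := hard_tree_card shape tH.
have nT : #|T| + 2 = #|V| by nlia.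
have cT : ncomp g T = 2 by apply: ncomp2 => //; apply: ncomp_le2; rewrite ?cY.
move: off; rewrite far_HJ // => off; rewrite off tH whole_treeE cT nT !eqxx /= andbT.
by case/andP: off => _ /negbTE->; nlia.
Qed.

Lemma jjs_setU T i j : T :&: jjs i j :|: (H :|: \bigcup_(k | (k != i) && (k != j)) J k) =
  T :|: (H :|: \bigcup_(k | (k != i) && (k != j)) J k).
Proof.
apply/setP=> e; rewrite !in_setU in_setI !in_setU.
case: (boolP (e \in T)) => //= _; have := edge_cover shape e.
case: (e \in H); rewrite ?orbT //; case: (e \in S); rewrite ?orbT //= !orbF.
case/existsP=> k ek; have [ki|ki] := eqVneq k i; first by rewrite -ki ek.
have [kj|kj] := eqVneq k j; first by rewrite -kj ek orbT.
by apply/orP; right; apply/bigcupP; exists k; rewrite ?ki.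
Qed.

(** T already spans the edges that the contraction adds. *)
Lemma ncomp_jjs T i j : treeH 1 T ->
  (forall k, (k != i) && (k != j) -> treeJ k 1 T) ->
  ncomp g (T :&: jjs i j :|: (H :|: \bigcup_(k | (k != i) && (k != j)) J k)) = ncomp g T.
Proof.
move=> tH tJ; rewrite jjs_setU; apply: spans_ncomp; first exact/subset_spans/subsetUl.
by apply: spansU; [apply: subset_spans | apply: (trees_spans shape)].
Qed.

Lemma far_jjs T i j : i != j -> treeH 1 T ->
  (forall k, (k != i) && (k != j) -> treeJ k 1 T) ->
  far (jet_jet_soft G J S i j) (T :&: jjs i j) None = farT T.
Proof.
move=> nij tH tJ; have [_ dis wX cX] := jjs_contr shape nij.
have hD : h0 \in ~: (VJ i :|: VJ j :|: VS).
  by rewrite in_setC !in_setU !(hard_jet_vertsF _ hH0) (hard_soft_vertsF hH0).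
apply/setP=> l; rewrite !inE /= -(keep_outD dis hD).
rewrite (conn_contracted _ hD dis wX cX) ?setUCr ?inE // => [|e _]; last by rewrite !inE.
congr (~~ _); rewrite jjs_setU; apply/idP/idP.
  by apply: spans_conn; apply: spansU; [apply: subset_spans | apply: (trees_spans shape)].
exact/conn_sub/subsetUl.
Qed.

Lemma card_jjs T i j : i != j ->
  #|T :&: jjs i j| = #|T :&: J i| + #|T :&: J j| + #|T :&: S|.
Proof.
move=> nij; rewrite !setIUr !cardsU_disjoint //.
  apply/pred0P => e /=; rewrite !in_setI; apply/andP => -[/andP[_ ei] /andP[_ ej]].
  by rewrite (jet_inj shape ei ej) eqxx in nij.
apply/pred0P => e /=; rewrite in_setU !in_setI; apply/andP => -[eij /andP[_ eS]].
by case/orP: eij => /andP[_ /(jet_softF shape)]; rewrite eS.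
Qed.

Lemma jets_pair_card T i j : i != j -> treeJ i 2 T -> treeJ j 2 T ->
  (forall k, (k != i) && (k != j) -> treeJ k 1 T) ->
  \sum_k #|T :&: J k| + 2 = \sum_k #|VJ k|.
Proof.
move=> nij ti tj tk; have <- : #|[set i; j]| = 2 by rewrite cards2 nij.
rewrite -sum_mem_card -big_split /=; apply: eq_bigr => k _; rewrite !inE.
have [->|ki] := eqVneq k i; first by have := jet_tree_card shape ti; nlia.
have [->|kj] := eqVneq k j; first by have := jet_tree_card shape tj; nlia.
by have := jet_tree_card shape (tk k _); rewrite ki kj addn1 addn0 => /(_ isT)[].
Qed.

(** The left side does not mention the remaining jets: it is the weight that forces spanning trees
    there. Backwards, contracting H and these jets keeps the number of components, so T inherits it
    from its trace on J_i, J_j and S. *)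
Lemma leading_pp_cut T i j : i != j -> (forall A, pp_cut i j A -> ~~ on_shell A) ->
  [&& spanning_tree g 2 T, weight T + on_shell (farT T) <= w0, pp_cut i j (farT T),
    treeH 1 T, treeJ i 2 T, treeJ j 2 T & loops (soft_tilde G S) (T :&: S) == 1] =
  [&& treeH 1 T, treeJJS i j 2 T,
    pp_cut i j (far (jet_jet_soft G J S i j) (T :&: jjs i j) None),
    treeJ i 2 T, treeJ j 2 T, loops (soft_tilde G S) (T :&: S) == 1
    & [forall (k | (k != i) && (k != j)), treeJ k 1 T]].
Proof.
move=> nij offA; have cj := card_jjs T nij.
have cards := card_cover shape T; have cardY := card_HJ shape T.
have cardV := card_verts shape; have we := weightE shape T; have we0 := min_weightE shape.
apply/idP/idP.
  case/and5P; rewrite whole_treeE => /andP[/eqP cT /eqP nT] le pp tH /and3P[ti tj lS].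
  have fT := forestE cT nT; have hc := hard_tree_card shape tH.
  have ic := jet_tree_card shape ti; have jc := jet_tree_card shape tj.
  have tk k : (k != i) && (k != j) -> treeJ k 1 T.
    move=> /andP[ki kj]; apply: (forest_jet_tree shape) => //.
    (* Every jet trace is bounded by its number of vertices, minus one for i and j, while the weight
       bounds the sum from below; hence equality throughout. *)
    suff /(_ k) : forall k, #|T :&: J k| + (k \in [set i; j]) = #|VJ k|.
      by rewrite !inE (negbTE ki) (negbTE kj) addn0 addn1 => ->.
    apply: eq_of_leq_sum => [l|].
      rewrite !inE; have [->|li] := eqVneq l i; first by rewrite -ltnS -ic ltn_add2l.
      have [->|lj] := eqVneq l j; first by rewrite -ltnS -jc ltn_add2l.
      by rewrite addn0; apply: (forest_jet_le shape).
    rewrite big_split /= sum_mem_card cards2 nij.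
    have le' := leq_trans (leq_addr _ _) le.
    by clear -we we0 cardY cardV hc nT le'; nlia.
  have sJ := jets_pair_card nij ti tj tk.
  rewrite tH ti tj lS far_jjs // pp (jjs_treeE shape _ _ nij) ncomp_jjs // cT eqxx /=.
  by apply/andP; split; [nlia | apply/forall_inP].
case/and5P=> tH tJJS pp ti /and3P[tj lS /forall_inP tk].
have sJ := jets_pair_card nij ti tj tk; have hc := hard_tree_card shape tH.
have ic := jet_tree_card shape ti; have jc := jet_tree_card shape tj.
move: tJJS pp; rewrite (jjs_treeE shape _ _ nij) ncomp_jjs // far_jjs // =>
  /andP[/eqP cT /eqP nJ] pp.
have nT : #|T| + 2 = #|V| by nlia.
rewrite whole_treeE cT nT !eqxx pp tH ti tj lS (negbTE (offA _ pp)) /= andbT.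
by nlia.
Qed.

Hypothesis legs3 : 0 < K -> 2 < #|leg K M|.

Lemma K_gt0 i : 0 < K. Proof. exact: leq_ltn_trans (ltn_ord i). Qed.

Lemma legs2 i : 1 < #|leg K M|.
Proof. exact: ltnW (legs3 (K_gt0 i)). Qed.

(** If {p_i} were the complement of {p_j}, there would be only two legs. *)
Lemma p_cut_set1 i j : p_cut i [set inl j : leg K M] = (i == j).
Proof.
rewrite /p_cut /splits; apply/orP/eqP => [|->]; last by left.
case=> /eqP eA.
  by have := set11 (inl i : leg K M); rewrite -eA inE => /eqP[].
by have := legs3 (K_gt0 i); rewrite -(cardsC [set inl j : leg K M]) eA !cards1.
Qed.

Lemma p_cut_on_shell i A : p_cut i A -> on_shell A.
Proof. by move=> pA; apply/existsP; exists i. Qed.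

(** The factor lambda costs one unit, so the weight must lie strictly below w0. This excludes
    cutting H and allows at most one cut jet, through which the far legs must enter. *)
Lemma leading_on_shell T i : ncomp g T = 2 -> #|T| + 2 = #|V| -> p_cut i (farT T) ->
  weight T < w0 -> [/\ spansb G T H, farT T = [set inl i] & jets_cut G J T = [set i]].
Proof.
move=> cT nT pA le; have An0 := p_cut_neq0 (legs2 i) pA.
have sH : spansb G T H.
  apply/negPn/negP => nH; have [_ _] := weight_ge_hard_cut shape cT nT nH.
  by rewrite leqNgt le.
have le1 : #|jets_cut G J T| <= 1 by have := weight_ge_jets_cut shape cT nT sH; nlia.
have sub := far_jets_cut_sub shape hH0 sH.
case/set0Pn: An0 => l lA; have /imsetP[k kT lk] := subsetP sub l lA.
have cutE : jets_cut G J T = [set k].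
  by apply/eqP; rewrite eq_sym eqEcard sub1set kT cards1.
have AE : farT T = [set inl k].
  apply/eqP; rewrite eqEsubset sub1set -lk lA andbT; apply: subset_trans sub _.
  by rewrite cutE imset_set1 lk.
by move: pA; rewrite AE p_cut_set1 => /eqP->.
Qed.

Lemma conn_T_jetH T i v : treeH 1 T -> conn g (T :&: J i :|: H) h0 v -> conn g T h0 v.
Proof.
move=> tH; apply: spans_conn; apply: spansU.
  by apply: subset_spans; apply: subsetIl.
exact: hard_tree_spansT tH.
Qed.

Lemma card_jets_but T i : (forall k, k != i -> treeJ k 1 T) -> treeJ i 2 T ->
  \sum_k #|T :&: J k| + 1 = \sum_k #|VJ k|.
Proof.
move=> tJ tJi; rewrite (bigD1 i) //= [RHS](bigD1 i) //=.
have -> : \sum_(k < K | k != i) #|T :&: J k| = \sum_(k < K | k != i) #|VJ k|.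
  by apply: eq_bigr => k /tJ/(jet_tree_card shape); rewrite addn1 => -[].
by rewrite addnAC; congr (_ + _); have := jet_tree_card shape tJi; nlia.
Qed.

(** By submodularity the trace on HJ has no larger rank deficit than the trace on [H :|: J i],
    because together with all of H it spans the other jets. *)
Lemma ncomp_HJ_jet_cut T i : treeH 1 T -> (forall k, k != i -> treeJ k 1 T) ->
  treeJ i 2 T -> ncomp g (T :&: HJ) <= 2 + #|VS|.
Proof.
move=> tH tJ tJi; have sub : T :&: J i :|: T :&: H \subset T :&: HJ.
  by rewrite -setIUr setIS // setUC setUS // bigcup_sup.
have := ncomp_submod gT (H :|: J i) sub.
have -> : ncomp g (T :&: HJ :|: (H :|: J i)) = ncomp g HJ.
  apply: spans_ncomp.
    apply: spansU; first by apply: subset_spans; rewrite setUA subsetU // subsetUr.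
    move=> e /bigcupP[k _ ek]; have [ki|ki] := eqVneq k i.
      by apply: conn_edge; rewrite !inE -ki ek !orbT.
    have : conn g (T :&: J k :|: H) (src g e) (tgt g e).
      by apply: (jet_tree_spansUH shape (tJ k ki)).
    apply: conn_sub; rewrite subUset; apply/andP; split.
      by rewrite subsetU // setIS // subsetU // bigcup_sup // orbT.
    by rewrite setUA subsetU // subsetUr.
  apply: subset_spans; rewrite !subUset subsetIr subsetUl /= subsetU //.
  by rewrite bigcup_sup // orbT.
have := ncomp_J shape i; have cHJ := ncomp_HJ shape.
have -> : ncomp g (T :&: J i :|: T :&: H :|: (H :|: J i)) = ncomp g (H :|: J i).
  congr ncomp; apply/setUidPr; rewrite subUset.
  by rewrite !(subset_trans (subsetIr _ _)) ?subsetUr ?subsetUl.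
have -> : ncomp g (T :&: J i :|: T :&: H) = ncomp g (T :&: J i :|: H).
  apply: spans_ncomp; last by apply: subset_spans; rewrite setUS // subsetIr.
  apply: spansU; first exact/subset_spans/subsetUl.
  by apply: spans_trans (hard_tree_spans shape tH); apply/subset_spans/subsetUr.
by move: tJi; rewrite (jet_treeE shape) => /andP[/eqP]; nlia.
Qed.

Lemma leading_p_cut T i :
  [&& spanning_tree g 2 T, weight T + on_shell (farT T) <= w0 & p_cut i (farT T)] =
  [&& treeH 1 T, treeJ i 2 T,
      p_cut i (far (jet_tilde G J S i) (T :&: J i) None),
      [forall (k | k != i), treeJ k 1 T] & treeS 1 T].
Proof.
rewrite (p_cut_sub (legs2 i) (far_jet_sub shape hH0 T i)) (far_jet shape hH0) eqxx /=.
apply/idP/idP.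
  rewrite whole_treeE => /and3P[/andP[/eqP cT /eqP nT] le pA].
  rewrite (p_cut_on_shell pA) addn1 in le.
  have [sH AE cutE] := leading_on_shell cT nT pA le.
  have nHJ : ~~ spansb G T HJ.
    by apply: (far_spans shape hH0); rewrite AE; apply/set0Pn; exists (inl i); rewrite set11.
  have := leading_jets_cut shape cT nT sH nHJ; rewrite cutE cards1 => -[|tH tJ eS cS].
    by nlia.
  have tJi : treeJ i 2 T by have := tJ i; rewrite set11.
  rewrite tH tJi (soft_treeE shape) cS eqxx eS addn1 eqxx /= andbT; apply/andP; split.
    have : inl i \in farT T by rewrite AE set11.
    by rewrite inE => ni; apply: contra ni; apply: conn_T_jetH.
  by apply/forall_inP => k ki; have := tJ k; rewrite inE (negbTE ki).
case/and5P=> tH tJi npi /forall_inP tJ tS.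
have cJ := card_jets_but tJ tJi; have cY := ncomp_HJ_jet_cut tH tJ tJi.
have cTHJ := soft_tree_ncomp shape tS.
have nT : #|T| + 2 = #|V|.
  have := card_cover shape T; have := card_verts shape.
  by have := hard_tree_card shape tH; have := soft_tree_card shape tS; nlia.
have cT : ncomp g T = 2 by apply: ncomp2 => //; apply: ncomp_le2; rewrite ?cY.
have TX : spans g T (H :|: \bigcup_(k | k != i) J k) by apply: (trees_spans shape).
have TH : spans g T H by apply: (hard_tree_spansT shape).
(* Everything outside the jet J_i and S lies on the side of h0. *)
have c_other v : v \in VH :|: \bigcup_(k | k != i) VJ k -> conn g T h0 v.
  move=> vX; apply: spans_conn TX _; apply: (conn_hard_jets shape) => //.
  by rewrite in_setU hH0.
have AE : farT T = [set inl i].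
  apply/setP => l; rewrite !inE; case: (eqVneq l (inl i)) => [->|nl]; last first.
    apply/negbF/c_other; case: (att_hard_or_jet shape l) => [lH|[k lk kJ]].
      by rewrite in_setU lH.
    rewrite in_setU; apply/orP; right; apply/bigcupP; exists k => //.
    by apply: contraNN nl => /eqP <-; rewrite lk.
  (* If T connected p_i to h0, it would connect all of J_i to h0, as every vertex of \tilde J_i lies
     in the component of the auxiliary vertex or in that of p_i. Then T would span HJ and, like
     [T :|: HJ], have a single component. *)
  apply/negP => hi; suff: ncomp g T = 1 by rewrite cT.
  have sTHJ : spans g T HJ.
    apply: (conn_spans_HJ shape) => v; rewrite (nonsoft_verts shape) in_setU.
    case/orP=> [vH|/bigcupP[k _ vk]]; first by apply: c_other; rewrite in_setU vH.
    have [ki|ki] := eqVneq k i; last first.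
      by apply: c_other; rewrite in_setU; apply/orP; right; apply/bigcupP; exists k.
    rewrite {k}ki in vk; have [/(conn_T_jetH tH)//|nv] := boolP (conn g (T :&: J i :|: H) h0 v).
    have aJ : fg_att G (inl i) \in VJ i :|: VH.
      by rewrite in_setU; case: (att_hard_or_jet shape (inl i)) => [->|[k [<-] ->]]; rewrite ?orbT.
    have vU : v \in VJ i :|: VH by rewrite in_setU vk.
    have hU : h0 \in VJ i :|: VH by rewrite in_setU hH0 orbT.
    apply: conn_trans hi _; apply: spans_conn (_ : conn g (T :&: J i :|: H) _ _).
      by apply: spansU => //; apply: subset_spans; apply: subsetIl.
    have c2 : ncomp (jet_tilde G J S i) (T :&: J i) <= 2.
      by case/and3P: tJi => _ /eqP->.
    rewrite -(conn_jet shape hH0) //.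
    have wE : ends_in (jet_tilde G J S i) (verts (jet_tilde G J S i)) (T :&: J i).
      exact: ends_contracted.
    have := @ncomp2_conn _ _ _ _ _ (T :&: J i) (keep (VJ i) h0)
       (keep (VJ i) (fg_att G (inl i))) (keep (VJ i) v) wE c2.
    rewrite !(conn_jet shape hH0) //; apply=> //; exact: contracted_verts.
  rewrite -cTHJ; apply: spans_ncomp; last exact/subset_spans/subsetUl.
  by apply: spansU => //; apply: subset_spans.
rewrite whole_treeE cT nT !eqxx AE p_cut_set1 eqxx andbT /=.
have := weightE shape T; have := min_weightE shape; have := card_HJ shape T.
have := card_verts shape; have := hard_tree_card shape tH.
by have := soft_tree_card shape tS; case: on_shell; nlia.
Qed.

End LeadingTwoTrees.

(** * The least weight, and exhaustiveness of the types *)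

Section LeadingCases.
Variables (K M N : nat) (V : finType) (G : feynman_graph K M N V).
Variables (H : {set 'I_N}) (J : 'I_K -> {set 'I_N}) (S : {set 'I_N}).
Hypothesis shape : region_shape G H J S.
Implicit Types (T X Y F : {set 'I_N}) (W D : {set V}) (e : 'I_N) (v w : V) (i j : 'I_K).
Implicit Types (A : {set leg K M}).
Local Notation g := (whole G).
Local Notation VH := (hard_verts G J S).
Local Notation VS := (soft_verts G S).
Local Notation HJ := (H :|: \bigcup_i J i).
Local Notation gT := (erefl : verts g = _).
Local Notation treeH k T := (spanning_tree (hard_graph G H J S) k (T :&: H)).
Local Notation treeJ i k T := (spanning_tree (jet_tilde G J S i) k (T :&: J i)).
Local Notation w0 := (min_weight G J S).
Local Notation weight := (weight J S).

(** Greedy construction: a basis of H is extended to one of HJ and then of G, which makes both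
    traces as large as possible. It shows that w0 is attained. *)
Lemma exists_leading_tree : ncomp g setT = 1 ->
  exists T, spanning_tree g 1 T && (weight T <= w0).
Proof.
move=> connG; have f0 : forest g set0.
  by rewrite /forest cards0 (ncomp0 gT).
have [A [_ AH fA cA]] := forest_extend gT (sub0set H) f0.
have AHJ : A \subset HJ by rewrite subsetU ?AH.
have [B [AB BHJ fB cB]] := forest_extend gT AHJ fA.
have [T [BT _ fT cT]] := forest_extend gT (subsetT B) fB.
rewrite connG in cT; exists T.
have nT : #|T| + 1 = #|V| by move: fT => /eqP; rewrite cT.
rewrite whole_treeE cT nT !eqxx /=.
have : #|B| <= #|T :&: HJ| by rewrite subset_leq_card // subsetI BT.
have : #|A| <= #|T :&: H|.
  by rewrite subset_leq_card // subsetI AH (subset_trans AB).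
move: fA fB => /eqP fA /eqP fB.
have := ncomp_H shape; have := ncomp_HJ shape; have := weightE shape T.
by have := min_weightE shape; nlia.
Qed.

Lemma tree_weight_ge T : spanning_tree g 1 T -> w0 <= weight T.
Proof.
rewrite whole_treeE => /andP[/eqP cT /eqP nT]; have fT := forestE cT nT.
have := forest_bound H fT; have := forest_bound HJ fT.
have := ncomp_H shape; have := ncomp_HJ shape; have := weightE shape T.
by have := min_weightE shape; nlia.
Qed.

Lemma splitsC (B A : {set leg K M}) : splits B (~: A) = splits B A.
Proof. by rewrite /splits setCK orbC. Qed.

Lemma p_cutC i A : p_cut i (~: A) = p_cut i A. Proof. exact: splitsC. Qed.

Lemma pp_cutC i j A : pp_cut i j (~: A) = pp_cut i j A. Proof. exact: splitsC. Qed.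

Lemma on_shellC A : on_shell (~: A) = on_shell A.
Proof. by apply: eq_existsb => i; apply: p_cutC. Qed.

Lemma no_extC A : no_ext (~: A) = no_ext A.
Proof. by rewrite /no_ext setCK orbC. Qed.

Lemma off_shellC A : off_shell (~: A) = off_shell A.
Proof. by rewrite /off_shell no_extC on_shellC. Qed.

Hypothesis legs3 : 0 < K -> 2 < #|leg K M|.

Lemma p_cut_inj i j A : p_cut i A -> p_cut j A -> i = j.
Proof.
move=> iA /orP[/eqP eA|/eqP eA].
  by move: iA; rewrite eA p_cut_set1 // => /eqP.
by move: iA; rewrite -p_cutC eA p_cut_set1 // => /eqP.
Qed.

Variable h0 : V.
Hypothesis hH0 : h0 \in VH.
Local Notation A T := (far g T h0).
Local Notation condII i j T := [&& pp_cut i j (A T), treeH 1 T, treeJ i 2 T,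
  treeJ j 2 T & loops (soft_tilde G S) (T :&: S) == 1].

Hypothesis ppF : forall i j B, i != j -> @pp_cut K M i j B -> ~~ on_shell B.

(** If H is spanned and only one jet is cut, the weight may be w0 - 1; but then the cut is some
    {p_i}, and its factor lambda supplies the missing unit. *)
Lemma two_tree_weight_ge T : spanning_tree g 2 T -> ~~ no_ext (A T) ->
  w0 <= weight T + on_shell (A T).
Proof.
rewrite whole_treeE => /andP[/eqP cT /eqP nT] /norP[An0 _].
have [sH|nH] := boolP (spansb G T H); last first.
  by have [_ _ le] := weight_ge_hard_cut shape cT nT nH; apply: leq_trans le (leq_addr _ _).
have sub := far_jets_cut_sub shape hH0 sH.
have lem := weight_ge_jets_cut shape cT nT sH.
case/set0Pn: An0 => l lA; have /imsetP[i iT li] := subsetP sub l lA.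
have [c1|c1] := leqP #|jets_cut G J T| 1; last by nlia.
have cutE : jets_cut G J T = [set i].
  by apply/eqP; rewrite eq_sym eqEcard sub1set iT cards1.
have AE : A T = [set inl i].
  apply/eqP; rewrite eqEsubset sub1set -li lA andbT; apply: subset_trans sub _.
  by rewrite cutE imset_set1 li.
have -> : on_shell (A T) by apply/existsP; exists i; rewrite AE p_cut_set1.
by move: lem; rewrite cutE cards1; nlia.
Qed.

(** A single far leg would make the cut on-shell, so at least two jets are cut; the weight allows at
    most two. *)
Lemma leading_jet_pair T : ncomp g T = 2 -> #|T| + 2 = #|V| -> spansb G T H ->
  weight T <= w0 -> off_shell (A T) ->
  exists i j, [/\ j < i, condII i j T & jets_cut G J T = [set i; j]].
Proof.
move=> cT nT sH le off; have An0 := off_shell_neq0 off.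
have nHJ := far_spans shape hH0 An0.
have sub := far_jets_cut_sub shape hH0 sH.
have cAle := subset_leq_card sub; rewrite card_imset in cAle; last by move=> ? ? [].
have lem := weight_ge_jets_cut shape cT nT sH.
have cA2 : 1 < #|A T|.
  rewrite ltnNge; apply/negP => c1; case/set0Pn: An0 => l lA.
  have /imsetP[i _ li] := subsetP sub l lA.
  have eA : A T = [set l] by apply/eqP; rewrite eq_sym eqEcard sub1set lA cards1.
  case/andP: off => _ /negP; apply; apply/existsP; exists i.
  by rewrite eA li p_cut_set1.
have cut2 : #|jets_cut G J T| == 2 by rewrite eqn_leq (leq_trans cA2 cAle) andbT; nlia.
have eA : A T = [set inl i | i in jets_cut G J T].
  by apply/eqP; rewrite eqEcard sub card_imset ?(eqP cut2) // => ? ? [].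
have := leading_jets_cut shape cT nT sH nHJ; rewrite (eqP cut2) leq_add2r => /(_ le)[tH tJ eS cS].
have key i j : i != j -> jets_cut G J T = [set i; j] -> condII i j T.
  move=> nij cutE; rewrite tH eA cutE imsetU !imset_set1 /pp_cut /splits eqxx /=.
  have := tJ i; rewrite cutE set21 => ->; have := tJ j; rewrite cutE set22 => -> /=.
  by have := soft_loopsE shape T; rewrite cS => lS; apply/eqP; nlia.
have /cards2P[i [j [nij cutE]]] := cut2.
have [ij|ji|/val_inj eij] := ltngtP i j; last by rewrite eij eqxx in nij.
  have cutE' : jets_cut G J T = [set j; i] by rewrite setUC.
  by exists j, i; split=> //; apply: key => //; rewrite eq_sym.
by exists i, j; split=> //; apply: key.
Qed.

(** A sum of booleans equal to 1 says in one formula that exactly one type applies, and can be used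
    directly as a multiplicity in the decomposition of F. *)
Lemma leading_cases T : spanning_tree g 2 T ->
  weight T + on_shell (A T) <= w0 -> ~~ no_ext (A T) ->
  \sum_(i < K) p_cut i (A T) + (off_shell (A T) && treeH 2 T)
  + \sum_(i < K) \sum_(j < K | j < i) condII i j T = 1.
Proof.
rewrite whole_treeE => /andP[/eqP cT /eqP nT] le next.
have [on|non] := boolP (on_shell (A T)).
  have /existsP[i0 pi0] := on; rewrite /off_shell on andbF /= addn0.
  rewrite (bigD1 i0) //= pi0 big1 => [|i ii0]; last first.
    by apply/eqP; rewrite eqb0; apply: contra ii0 => pi; rewrite (p_cut_inj pi pi0).
  rewrite big1 // => i _; rewrite big1 // => j ji; apply/eqP; rewrite eqb0.
  have nij : i != j by apply: contraTneq ji => ->; rewrite ltnn.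
  by apply/negP => /and5P[/(ppF nij)]; rewrite on.
have off : off_shell (A T) by rewrite /off_shell next.
rewrite (negbTE non) addn0 in le.
rewrite off big1 ?add0n /= => [|i _]; last first.
  by apply/eqP; rewrite eqb0; apply: contra non => pi; apply/existsP; exists i.
have [sH|nH] := boolP (spansb G T H); last first.
  have [hc yc _] := weight_ge_hard_cut shape cT nT nH.
  have eH : #|T :&: H| + 2 = #|VH|.
    by have := weightE shape T; have := min_weightE shape; nlia.
  rewrite (forest_hard_tree shape (forestE cT nT) eH) big1 // => i _.
  rewrite big1 // => j _; apply/eqP; rewrite eqb0; apply/negP => /and5P[_ tH _ _ _].
  by have := hard_tree_card shape tH; nlia.
have [a [b [ba cII cutE]]] := leading_jet_pair cT nT sH le off.
have /and5P[_ tH _ _ _] := cII.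
have -> : treeH 2 T = false.
  by apply/negP => tH2; have := hard_tree_card shape tH; have := hard_tree_card shape tH2; nlia.
(* A trace cannot be both a spanning tree and a spanning 2-tree, so a pair of type II consists of
   the cut jets; the condition j < i fixes its order. *)
have tJ k : treeJ k 2 T -> k \in [set a; b].
  have := leading_jets_cut shape cT nT sH (far_spans shape hH0 (off_shell_neq0 off)).
  rewrite cutE cards2 neq_ltn ba orbT leq_add2r => /(_ le)[_ tJ _ _] tk.
  have := jet_tree_card shape tk; have := jet_tree_card shape (tJ k).
  by case: (k \in _) => //; nlia.
rewrite add0n (bigD1 a) //= (bigD1 b) //= cII big1 => [|j /andP[ja jb]]; last first.
  apply/eqP; rewrite eqb0; apply/negP => /and5P[_ _ _ /tJ tj _].
  by move: tj; rewrite !inE (negbTE jb) orbF => /eqP ej; rewrite ej ltnn in ja.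
rewrite big1 // => i ia; rewrite big1 // => j ji; apply/eqP; rewrite eqb0.
apply/negP => /and5P[_ _ /tJ ti /tJ tj _]; move: ti tj ji; rewrite !inE (negbTE ia) /=.
by move=> /eqP-> /orP[]/eqP->; rewrite ?ltnn // ltnNge ltnW.
Qed.

End LeadingCases.

Local Open Scope ring_scope.

(** * Kinematics *)

Section Kinematics.
Variables (R : realFieldType) (d K M N : nat) (V : finType) (G : feynman_graph K M N V).
Variables (lam1 Q2 : R) (mom : R -> leg K M -> 'rV[R]_d.+1).
Hypothesis kin : wide_angle G lam1 Q2 mom.
Implicit Types (A B : {set leg K M}) (a b : 'rV[R]_d.+1).

Lemma mdotC a b : mdot a b = mdot b a.
Proof. by rewrite /mdot mulrC; congr (_ - _); apply: eq_bigr => i _; rewrite mulrC. Qed.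

Lemma mdotDr a b c : mdot a (b + c) = mdot a b + mdot a c.
Proof.
rewrite /mdot mxE (eq_bigr (fun i => a 0 (lift ord0 i) * b 0 (lift ord0 i) +
  a 0 (lift ord0 i) * c 0 (lift ord0 i))) => [|i _]; last by rewrite mxE mulrDr.
by rewrite big_split /=; ring.
Qed.

Lemma mdotNr a b : mdot a (- b) = - mdot a b.
Proof.
rewrite /mdot mxE (eq_bigr (fun i => - (a 0 (lift ord0 i) * b 0 (lift ord0 i)))) => [|i _].
  by rewrite sumrN; ring.
by rewrite mxE mulrN.
Qed.

Lemma mdotN a b : mdot (- a) (- b) = mdot a b.
Proof. by rewrite mdotNr mdotC mdotNr opprK mdotC. Qed.

Lemma mdot00 : mdot (0 : 'rV[R]_d.+1) 0 = 0.
Proof. by have := mdotDr 0 0 0; rewrite addr0; lra. Qed.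

Lemma mdot_sqrD a b : mdot (a + b) (a + b) = mdot a a + mdot b b + mdot a b *+ 2.
Proof. by rewrite mdotDr ![mdot (a + b) _]mdotC !mdotDr [mdot b a]mdotC mulr2n; ring. Qed.

Lemma scales_separate (f1 f2 f3 h : R -> R) :
  scales lam1 Q2 1 f1 -> scales lam1 Q2 1 f2 -> scales lam1 Q2 1 f3 ->
  scales lam1 Q2 0 h ->
  exists2 lam, 0 < lam <= lam1 & `|f1 lam| + `|f2 lam| + `|f3 lam| < `|h lam|.
Proof.
have lam1_gt0 := wa_lam1 kin; have Q2_gt0 := wa_Q2 kin.
move=> [c1 [C1 [_ C1_gt0 F1]]] [c2 [C2 [_ C2_gt0 F2]]] [c3 [C3 [_ C3_gt0 F3]]].
move=> [c [C0 [c_gt0 _ Fh]]]; pose C := C1 + C2 + C3.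
have C_gt0 : 0 < C by rewrite /C; lra.
(* Here the three upper bounds add up to at most half of the lower bound c * Q2 for h. *)
pose lam := Num.min lam1 (c / (2 * C)).
have lamP : 0 < lam <= lam1.
  by rewrite lt_min lam1_gt0 divr_gt0 ?mulr_gt0 //= ge_min lexx.
have lamC : C * lam <= c / 2.
  have : lam <= c / (2 * C) by rewrite ge_min lexx orbT.
  rewrite -(ler_pM2l C_gt0) => le; apply: le_trans le _.
  by rewrite le_eqVlt; apply/orP; left; apply/eqP; field; rewrite gt_eqF.
exists lam => //; have := F1 _ lamP; have := F2 _ lamP; have := F3 _ lamP.
have := Fh _ lamP; rewrite expr0 mul1r !expr1
  => /andP[le_h _] /andP[_ le3] /andP[_ le2] /andP[_ le1].
have : C * lam * Q2 <= c / 2 * Q2 by rewrite ler_pM2r.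
have : c / 2 * Q2 < c * Q2 by rewrite ltr_pM2r //; lra.
by rewrite /C; lra.
Qed.

Lemma sum_mom_setC lam A : 0 < lam <= lam1 ->
  \sum_(l in ~: A) mom lam l = - \sum_(l in A) mom lam l.
Proof.
move=> lamP; have := wa_conservation kin lamP.
rewrite (bigID (mem A)) /= addrC => /eqP; rewrite addr_eq0 => /eqP <-.
by apply: eq_bigl => l; rewrite inE.
Qed.

Lemma msqC lam A : 0 < lam <= lam1 -> msq (mom lam) (~: A) = msq (mom lam) A.
Proof. by move=> lamP; rewrite /msq sum_mom_setC // mdotN. Qed.

Lemma msq_no_ext lam A : 0 < lam <= lam1 -> no_ext A -> msq (mom lam) A = 0.
Proof.
move=> lamP; have m0 : msq (mom lam) set0 = 0 by rewrite /msq big_set0 mdot00.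
by case/orP=> [/eqP->//|/eqP A0]; rewrite -msqC // A0.
Qed.

(* With two legs, p_i would be minus the other momentum l; but then p_i^2 would be of the
   order of l^2 (if l is some q_j) or of p_i.l (if l is some p_k). *)
Lemma three_legs : (0 < K)%N -> (2 < #|leg K M|)%N.
Proof.
move=> K0; pose i : 'I_K := Ordinal K0; rewrite ltnNge; apply/negP => le2.
have lam1_gt0 := wa_lam1 kin; have Q2_gt0 := wa_Q2 kin.
have pi := wa_pp kin i.
have le1 : (#|~: [set inl i : leg K M]| <= 1)%N.
  by rewrite -ltnS (leq_trans _ le2) // -[X in (_ <= X)%N](cardsC [set inl i : leg K M]) cards1.
have big_h h : scales lam1 Q2 0 h -> (forall lam, 0 < lam <= lam1 ->
    `|h lam| = `|mdot (mom lam (inl i)) (mom lam (inl i))|) -> False.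
  move=> hs eh; have [lam lamP] := scales_separate pi pi pi hs.
  rewrite eh //; set n := `|_| => lt; have : 0 <= n by rewrite normr_ge0.
  by lra.
have sC lam : 0 < lam <= lam1 -> \sum_(l in ~: [set inl i]) mom lam l = - mom lam (inl i).
  by move=> lamP; rewrite sum_mom_setC // big_set1.
(* With a single leg, conservation gives p_i = 0, against the lower bound on its square. *)
have [/eqP|c1] := posnP #|~: [set inl i : leg K M]|.
  rewrite cards_eq0 => /eqP e0.
  have lamP : 0 < lam1 <= lam1 by rewrite lam1_gt0 lexx.
  have := sC _ lamP; rewrite e0 big_set0 => /eqP; rewrite eq_sym oppr_eq0 => /eqP m0.
  have [c [C [c_gt0 _ /(_ _ lamP)/andP[le _]]]] := pi.
  by move: le; rewrite m0 mdot00 normr0 expr1 leNgt !mulr_gt0.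
have /cards1P[l el] : #|~: [set inl i : leg K M]| == 1%N by rewrite eqn_leq le1.
have il : l != inl i by have := set11 l; rewrite -el !inE.
have ml lam : 0 < lam <= lam1 -> mom lam l = - mom lam (inl i).
  by move=> /sC; rewrite el big_set1.
case: l il el ml => [k|q] il el ml.
  have ki : k != i by apply: contra il => /eqP->.
  apply: (big_h _ (wa_pkpl kin ki)) => lam lamP.
  by rewrite ml // mdotC mdotNr normrN.
by apply: (big_h _ (wa_qq kin q)) => lam lamP; rewrite ml // mdotN.
Qed.

(* Otherwise p_k = - (p_i + p_j) for some k, and p_k^2 is of the order of p_i.p_j. *)
Lemma pp_cut_off_shell (i j : 'I_K) A : i != j -> pp_cut i j A -> ~~ on_shell A.
Proof.
move=> nij; wlog eA : A / A = [set inl i; inl j].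
  move=> H2 /orP[/eqP eA|/eqP eA]; first by apply: (H2 A) => //; rewrite /pp_cut /splits eA eqxx.
  by rewrite -on_shellC; apply: (H2 (~: A)) => //; rewrite /pp_cut /splits eA eqxx.
move=> _; apply/negP => /existsP[k /orP[/eqP ek|/eqP ek]].
  have := cards2 (inl i : leg K M) (inl j); rewrite -eA ek cards1.
  by rewrite (inj_eq (@inl_inj _ _)) nij.
have mk lam : 0 < lam <= lam1 ->
    mdot (mom lam (inl k)) (mom lam (inl k)) = mdot (mom lam (inl i)) (mom lam (inl i))
      + mdot (mom lam (inl j)) (mom lam (inl j)) + mdot (mom lam (inl i)) (mom lam (inl j)) *+ 2.
  move=> lamP; rewrite -mdot_sqrD.
  have -> : mom lam (inl k) = - (mom lam (inl i) + mom lam (inl j)).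
    rewrite [LHS](_ : _ = \sum_(l in [set inl k]) mom lam l); last by rewrite big_set1.
    rewrite -ek sum_mom_setC // eA.
    by rewrite big_setU1 ?big_set1 // inE (inj_eq (@inl_inj _ _)).
  by rewrite mdotN.
have [lam lamP] := scales_separate (wa_pp kin i) (wa_pp kin j) (wa_pp kin k) (wa_pkpl kin nij).
rewrite mk // ltNge => /negP; apply.
set c := mdot _ _; set a := mdot _ _; set b := mdot _ _.
have : `|c *+ 2| <= `|a| + `|b| + `|a + b + c *+ 2|.
  have {1}-> : c *+ 2 = (a + b + c *+ 2) - (a + b) by ring.
  by apply: le_trans (ler_normB _ _) _; rewrite [leLHS]addrC lerD2r ler_normD.
by rewrite normrMn; have := normr_ge0 c; lra.
Qed.
End Kinematics.

(** * Polynomials *)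

Section SubsetSums.
Variables (R : realFieldType) (N : nat).
Implicit Types (E T : {set 'I_N}) (c : {set 'I_N} -> R).

Definition mono E : {mpoly R[N]} := \prod_(e in E) 'X_e.

(** Common form of all the polynomials of the theorem at lambda = 1, which are then compared through
    their coefficient functions c. *)
Definition ssum E c : {mpoly R[N]} :=
  \sum_(T : {set 'I_N} | T \subset E) c T *: mono (E :\: T).

(** Allows the coefficient function of one factor to be evaluated on the edge sets of the whole
    product. *)
Definition local_on E c := forall T, c (T :&: E) = c T.

Lemma eq_ssum E c c' : (forall T, T \subset E -> c T = c' T) -> ssum E c = ssum E c'.
Proof. by move=> cc'; apply: eq_bigr => T /cc'->. Qed.

Lemma monoU E E' : [disjoint E & E'] -> mono (E :|: E') = mono E * mono E'.
Proof.
move=> dis; rewrite /mono [X in _ = X * _]big_mkcond [X in _ = _ * X]big_mkcond -big_split /=.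
rewrite big_mkcond; apply: eq_bigr => e _.
rewrite inE; have [eE|eE] := boolP (e \in E); last by rewrite mul1r.
by rewrite (disjointFr dis eE) mulr1.
Qed.

Lemma local_onM E E' c c' : local_on E c -> local_on E' c' ->
  local_on (E :|: E') (fun T => c T * c' T).
Proof.
move=> lc lc' T; rewrite -[c (_ :&: _)]lc -[c' (_ :&: _)]lc' -!setIA.
by rewrite setUK [_ :&: E']setIC setKU lc lc'.
Qed.

Lemma ssumM E E' c c' : [disjoint E & E'] -> local_on E c -> local_on E' c' ->
  ssum E c * ssum E' c' = ssum (E :|: E') (fun T => c T * c' T).
Proof.
move=> dis lc lc'; rewrite /ssum big_distrlr /= pair_big /=.
have disI T T' : T \subset E -> T' \subset E' -> (T :|: T') :&: E = T.
  move=> TE TE'; apply/setP=> e; rewrite !inE.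
  have [eE|eE] := boolP (e \in E); last first.
    by rewrite andbF; symmetry; apply: contraNF eE; apply/subsetP.
  rewrite andbT; case: (e \in T) => //=; apply/negP => /(subsetP TE').
  by rewrite (disjointFr dis eE).
have disI' T T' : T \subset E -> T' \subset E' -> (T :|: T') :&: E' = T'.
  move=> TE TE'; apply/setP=> e; rewrite !inE.
  have [eE|eE] := boolP (e \in E'); last first.
    by rewrite andbF; symmetry; apply: contraNF eE; apply/subsetP.
  rewrite andbT orbC; case: (e \in T') => //=; apply/negP => /(subsetP TE).
  by rewrite (disjointFl dis eE).
(* A subset of the union corresponds to the pair of its traces. *)
rewrite (reindex_onto (fun T : {set 'I_N} => (T :&: E, T :&: E')) (fun p => p.1 :|: p.2)) /=.
  apply: eq_big => [T|T _].
    rewrite !subsetIr /= -setIUr; apply/eqP/idP => [<-|]; first exact: subsetIr.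
    by move/setIidPl.
  rewrite lc lc' -scalerAl -scalerAr scalerA; congr (_ *: _).
  rewrite -monoU; first by rewrite setDIr setDIr !setDv !setU0 -setDUl.
  apply: disjointWl (disjointWr _ dis); apply: subsetDl.
by case=> T T' /= /andP[TE TE']; rewrite disI // disI'.
Qed.

Variables (K : nat) (F : 'I_K -> {set 'I_N}) (c : 'I_K -> {set 'I_N} -> R).
Hypothesis disj : forall i j e, e \in F i -> e \in F j -> i = j.
Hypothesis lc : forall i, local_on (F i) (c i).

Lemma local_on_prod (P : pred 'I_K) :
  local_on (\bigcup_(i | P i) F i) (fun T => \prod_(i | P i) c i T).
Proof.
move=> T; apply: eq_bigr => i Pi; rewrite -lc -setIA.
by have -> : \bigcup_(j | P j) F j :&: F i = F i; [apply/setIidPr/bigcup_sup | rewrite lc].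
Qed.

Lemma ssum_prod (P : pred 'I_K) : \prod_(i | P i) ssum (F i) (c i) =
  ssum (\bigcup_(i | P i) F i) (fun T => \prod_(i | P i) c i T).
Proof.
have PE : P =1 (fun i => i \in [set i | P i]) by move=> i; rewrite !inE.
rewrite (eq_bigl _ _ PE) (eq_bigl _ (fun i => F i) PE).
under [in RHS]eq_ssum => T _ do rewrite (eq_bigl _ _ PE).
elim/finset_ind: [set i | P i] => [|i A IH].
  rewrite !big_set0 /ssum (big_pred1 set0) => [|T]; last by rewrite subset0.
  by rewrite big_set0 scale1r /mono setDv big_set0.
have [iA|iA] := boolP (i \in A); first by rewrite (setUidPr _) ?sub1set.
rewrite !big_setU1 //= IH ssumM //.
- by apply: eq_ssum => T _; rewrite big_setU1.
- apply/pred0P => e /=; apply/andP => -[ei /bigcupP[j jA]] /(disj ei) ij.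
  by rewrite ij jA in iA.
- exact: local_on_prod.
Qed.

End SubsetSums.

(** * Leading terms, exponent vectors and weights *)

Section LeadingTerms.
Variables (R : realFieldType) (n : nat).
Implicit Types (P Q : {mpoly R[n]}) (v : 'rV[R]_n) (m : 'X_{1..n}).

Definition is_leading v P m :=
  all (fun m' => dot v (exponent R m) <= dot v (exponent R m')) (msupp P).

Lemma mcoeff_leading v P Q m :
  (leading v P Q)@_m = if is_leading v P m then Q@_m else 0.
Proof.
rewrite /leading raddf_sum /=.
rewrite (eq_bigr (fun m' => if m' == m then Q@_m else 0)) => [|m' _]; last first.
  by rewrite mcoeffZ mcoeffX; case: eqP => [->|_]; rewrite ?mulr1 ?mulr0.
rewrite -big_mkcondr /=; have [mQ|mQ] := boolP (m \in msupp Q).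
  rewrite big_mkcond (bigD1_seq m) //= eqxx andbT big1 => [|m' /negbTE->]; last by rewrite andbF.
  by rewrite addr0.
by rewrite (memN_msupp_eq0 mQ) if_same big1.
Qed.

Lemma leadingD v P Q Q' : leading v P (Q + Q') = leading v P Q + leading v P Q'.
Proof.
by apply/mpolyP => m; rewrite mcoeffD !mcoeff_leading mcoeffD; case: ifP; rewrite ?addr0.
Qed.

(** The m i need not be distinct: terms with the same monomial are kept or dropped together. *)
Lemma leading_sum v P (I : finType) (c : I -> R) (m : I -> 'X_{1..n}) :
  leading v P (\sum_i c i *: 'X_[m i]) =
  \sum_i (if is_leading v P (m i) then c i else 0) *: 'X_[m i].
Proof.
apply/mpolyP => k; rewrite mcoeff_leading !raddf_sum /=.
have [lk|lk] := boolP (is_leading v P k).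
  apply: eq_bigr => i _; rewrite !mcoeffZ !mcoeffX.
  by have [->|_] := eqVneq (m i) k; rewrite ?lk ?mulr0.
rewrite big1 // => i _; rewrite mcoeffZ mcoeffX.
by have [->|_] := eqVneq (m i) k; rewrite ?(negbTE lk) ?mul0r ?mulr0.
Qed.

Lemma mcoeff_sum_monomials (I : finType) (c : I -> R) (m : I -> 'X_{1..n}) k :
  (\sum_i c i *: 'X_[m i])@_k = \sum_(i | m i == k) c i.
Proof.
rewrite raddf_sum /= [RHS]big_mkcond; apply: eq_bigr => i _.
by rewrite mcoeffZ mcoeffX; case: eqP; rewrite ?mulr1 ?mulr0.
Qed.

Lemma mem_msupp_sum (I : finType) (c : I -> R) (m : I -> 'X_{1..n}) k :
  k \in msupp (\sum_i c i *: 'X_[m i]) -> exists2 i, c i != 0 & m i = k.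
Proof.
rewrite mcoeff_msupp mcoeff_sum_monomials => nz.
have [i /andP[/eqP mk ci]|none] := pickP (fun i => (m i == k) && (c i != 0)).
  by exists i.
rewrite big1 ?eqxx // in nz => i mk; apply/eqP.
by have := none i; rewrite mk /= => /negbFE.
Qed.

End LeadingTerms.

Section Monomials.
Variables (R : realFieldType) (N : nat).
Implicit Types (T : {set 'I_N}) (b : nat).

Definition mon T b : 'X_{1..N.+1} :=
  [multinom if unlift ord_max j is Some e then (e \notin T : nat) else b | j < N.+1].

Lemma mon_lift T b e : mon T b (lift ord_max e) = (e \notin T).
Proof. by rewrite mnmE liftK. Qed.

Lemma mon_max T b : mon T b ord_max = b.
Proof. by rewrite mnmE unlift_none. Qed.

Lemma mon_inj T T' b b' : mon T b = mon T' b' -> T = T' /\ b = b'.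
Proof.
move=> e; split; last by rewrite -(mon_max T b) e mon_max.
apply/setP => f; have := mon_lift T b f; rewrite e mon_lift.
by case: (f \in T') (f \in T) => -[].
Qed.

Lemma monE T b : lambda R N ^+ b * \prod_(e in setT :\: T) xl R e = 'X_[mon T b].
Proof.
rewrite mpolyXE_id (bigD1_ord ord_max) //= mon_max; congr (_ * _).
rewrite big_mkcond; apply: eq_bigr => e _; rewrite mon_lift !inE andbT.
by case: (e \in T); rewrite ?expr0 ?expr1.
Qed.

Lemma at_lambda1_mon T b : at_lambda1 'X_[mon T b] = mono R (~: T).
Proof.
rewrite /at_lambda1 comp_mpolyX (bigD1_ord ord_max) //= tnth_mktuple unlift_none expr1n mul1r.
rewrite /mono [RHS]big_mkcond; apply: eq_bigr => e _.
by rewrite tnth_mktuple liftK mon_lift inE; case: (e \in T); rewrite ?expr0 ?expr1.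
Qed.

Lemma at_lambda1_sum (c : {set 'I_N} -> R) (b : {set 'I_N} -> nat) :
  at_lambda1 (\sum_T c T *: 'X_[mon T (b T)]) = ssum setT c.
Proof.
rewrite /at_lambda1 raddf_sum /ssum /=; apply: eq_big => [T|T _]; first by rewrite subsetT.
by rewrite comp_mpolyZ -/(at_lambda1 _) at_lambda1_mon setTD.
Qed.

Lemma at_lambda1D (P Q : {mpoly R[N.+1]}) :
  at_lambda1 (P + Q) = at_lambda1 P + at_lambda1 Q.
Proof. exact: comp_mpolyD. Qed.

End Monomials.

Section GraphPolynomials.
Variables (R : realFieldType) (d K M N : nat) (V : finType) (g : graph K M N V).
Variable mom : leg K M -> 'rV[R]_d.+1.

Lemma Upoly_ssum :
  Upoly (xv R (N := N)) g = ssum (edges g) (fun T => (spanning_tree g 1 (T :&: edges g))%:R).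
Proof.
rewrite /Upoly /ssum big_mkcond [RHS]big_mkcond; apply: eq_bigr => T _.
have [TE|nTE] := boolP (T \subset edges g); last by rewrite /spanning_tree (negbTE nTE).
by rewrite (setIidPl TE); case: ifP => _; rewrite ?scale1r ?scale0r.
Qed.

Lemma Fpoly_ssum sel : Fpoly (xv R (N := N)) g mom 1 sel =
  ssum (edges g) (fun T => if spanning_tree g 2 (T :&: edges g) && sel (T :&: edges g)
                           then - msq mom (side g (T :&: edges g)) else 0).
Proof.
rewrite /Fpoly /ssum -sumrN big_mkcond [RHS]big_mkcond; apply: eq_bigr => T _.
have [TE|nTE] := boolP (T \subset edges g); last by rewrite /spanning_tree (negbTE nTE).
by rewrite (setIidPl TE); case: ifP => _; rewrite ?scale0r // scaleNr expr1n mul1r.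
Qed.

End GraphPolynomials.

Section LeadingPolynomials.
Variables (R : realFieldType) (d K M N : nat) (V : finType) (G : feynman_graph K M N V).
Variables (H : {set 'I_N}) (J : 'I_K -> {set 'I_N}) (S : {set 'I_N}).
Variable mom : leg K M -> 'rV[R]_d.+1.
Hypothesis shape : region_shape G H J S.
Implicit Types (T : {set 'I_N}) (b : nat) (A : {set leg K M}).
Local Notation g := (whole G).
Local Notation w0 := (min_weight G J S).
Local Notation weight := (weight J S).
Local Notation nv := (normal_vector R H S).
Local Notation LP := (LeePomeransky G mom).

Lemma U_lambda_sum : U_lambda R G =
  \sum_T (spanning_tree g 1 T)%:R *: 'X_[mon T 0].
Proof.
rewrite /U_lambda /Upoly big_mkcond; apply: eq_bigr => T _.
by case: ifP => _; rewrite ?scale0r // scale1r -monE expr0 mul1r.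
Qed.

Definition Fcoef (sel : pred {set 'I_N}) T : R :=
  if spanning_tree g 2 T && sel T then - msq mom (side g T) else 0.

Lemma F_lambda_sum sel : F_lambda G mom sel =
  \sum_T Fcoef sel T *: 'X_[mon T (on_shell (side g T))].
Proof.
rewrite /F_lambda /Fpoly -sumrN big_mkcond; apply: eq_bigr => T _; rewrite /Fcoef.
by case: ifP => _; rewrite ?scale0r // scaleNr -monE.
Qed.

Definition edge_weight (e : 'I_N) : nat := (\sum_i (e \in J i) + 2 * (e \in S))%N.

Lemma sum_edge_weight T : (\sum_e (e \in T) * edge_weight e = weight T)%N.
Proof.
rewrite /weight -sum_mem_card.
under [in RHS]eq_bigr => i _ do rewrite -sum_mem_card.
rewrite exchange_big big_distrr -big_split /=; apply: eq_bigr => e _.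
rewrite /edge_weight mulnDr big_distrr /= mulnCA; congr (_ + _)%N.
  by apply: eq_bigr => i _; rewrite inE; case: (e \in T); rewrite ?mul1n.
by rewrite inE; case: (e \in T); rewrite ?mul1n.
Qed.

Lemma normal_vector_edge e : nv 0 (lift ord_max e) = - (edge_weight e)%:R.
Proof.
rewrite mxE liftK /edge_weight; have := rs_partition shape e.
set n := (\sum_i (e \in J i))%N.
have [eH|eH] := boolP (e \in H); have [eS|eS] /= := boolP (e \in S); rewrite ?addn0 ?add0n.
- by nlia.
- move=> n0; have -> : n = 0%N by nlia.
  by rewrite oppr0.
- by move=> n0; have -> : n = 0%N by nlia.
- by move=> ->.
Qed.

Lemma dot_mon T b : dot nv (exponent R (mon T b)) = (weight T + b)%:R - (weight setT)%:R.
Proof.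
rewrite /dot (bigD1_ord ord_max) //= mxE unlift_none mul1r mxE mon_max.
rewrite (eq_bigr (fun e => - ((e \in ~: T) * edge_weight e)%N%:R)) => [|e _]; last first.
  by rewrite normal_vector_edge mxE mon_lift mulrC natrM mulrN inE.
rewrite sumrN -natr_sum sum_edge_weight.
have -> : weight setT = (weight T + weight (~: T))%N.
  rewrite -!sum_edge_weight -big_split; apply: eq_bigr => e _; rewrite !inE.
  by case: (e \in T); rewrite /= ?mul0n ?addn0 ?add0n.
by rewrite !natrD; ring.
Qed.

Lemma dot_mon_le T T' b b' :
  (dot nv (exponent R (mon T b)) <= dot nv (exponent R (mon T' b'))) =
  (weight T + b <= weight T' + b')%N.
Proof. by rewrite !dot_mon -(ler_nat R); apply/idP/idP => ?; lra. Qed.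

End LeadingPolynomials.

(** * Decomposition and factorisation of the leading polynomial *)

Section Factorisation.
Variables (R : realFieldType) (d K M N : nat) (V : finType) (G : feynman_graph K M N V).
Variables (lam1 Q2 : R) (mom : R -> leg K M -> 'rV[R]_d.+1) (lam : R).
Variables (H : {set 'I_N}) (J : 'I_K -> {set 'I_N}) (S : {set 'I_N}).
Hypothesis connG : ncomp (whole G) setT = 1%N.
Hypothesis kin : wide_angle G lam1 Q2 mom.
Hypothesis lamP : 0 < lam <= lam1.
Hypothesis shape : region_shape G H J S.
Variable h0 : V.
Hypothesis hH0 : h0 \in hard_verts G J S.
Implicit Types (T : {set 'I_N}) (b : nat) (A : {set leg K M}).
Local Notation g := (whole G).
Local Notation HJ := (H :|: \bigcup_i J i).
Local Notation treeH k T := (spanning_tree (hard_graph G H J S) k (T :&: H)).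
Local Notation treeHJ k T := (spanning_tree (hard_jet_graph G H J S) k (T :&: HJ)).
Local Notation treeJ i k T := (spanning_tree (jet_tilde G J S i) k (T :&: J i)).
Local Notation treeS k T := (spanning_tree (soft_tilde G S) k (T :&: S)).
Local Notation jjs i j := (J i :|: J j :|: S).
Local Notation treeJJS i j k T := (spanning_tree (jet_jet_soft G J S i j) k (T :&: jjs i j)).
Local Notation w0 := (min_weight G J S).
Local Notation weight := (weight J S).
Local Notation nv := (normal_vector R H S).
Local Notation LP := (LeePomeransky G (mom lam)).
Local Notation q := (msq (mom lam)).
Local Notation farT T := (far g T h0).

(** The type X is arbitrary so that the lemma serves both the predicates on cuts and the squared
    momenta. *)
Lemma side_whole (X : Type) (f : {set leg K M} -> X) T : (forall A, f (~: A) = f A) ->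
  spanning_tree g 2 T -> f (side g T) = f (farT T).
Proof.
move=> fC /and3P[_ /eqP cT _].
have wT : ends_in g (verts g) T by move=> e _; rewrite !inE.
have inV v : v \in verts g by rewrite inE.
by have [->|->] := side_far wT cT (inV h0) (fun l => inV _); rewrite ?fC.
Qed.

(** w0 is the minimum of the weight plus the power of lambda over the support: a spanning tree
    attains it, and no term with nonzero coefficient lies below. *)
Lemma is_leading_mon T b : is_leading nv LP (mon T b) = (weight T + b <= w0)%N.
Proof.
apply/allP/idP => [le|le m].
  have [T0 /andP[t0 w_le]] := exists_leading_tree shape connG.
  have /le : mon T0 0 \in msupp LP.
    (* The coefficient is 1: a monomial determines its forest, and a 2-tree has one edge less than a
       tree. *)
    rewrite mcoeff_msupp /LeePomeransky mcoeffD U_lambda_sum F_lambda_sum.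
    rewrite !mcoeff_sum_monomials (big_pred1 T0) => [|T']; last first.
      by apply/eqP/eqP => [/mon_inj[]|->].
    rewrite t0 big1 ?addr0 ?oner_neq0 // => T' /eqP/mon_inj[-> _].
    rewrite /Fcoef; case: ifP => // /andP[t2 _].
    by move: t0 t2; rewrite !whole_treeE => /andP[_ /eqP<-] /andP[_]; rewrite eqn_add2l.
  rewrite (dot_mon_le _ shape) addn0 => le'.
  exact: leq_trans le' w_le.
rewrite /LeePomeransky => /msuppD_le; rewrite mem_cat => /orP[].
  rewrite U_lambda_sum => /mem_msupp_sum[T']; rewrite pnatr_eq0 eqb0 negbK => t1 <-.
  rewrite (dot_mon_le _ shape) addn0.
  by apply: leq_trans le _; apply: (tree_weight_ge shape).
rewrite F_lambda_sum => /mem_msupp_sum[T']; rewrite /Fcoef; case: ifP; rewrite ?eqxx // andbT.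
move=> t2; rewrite oppr_eq0 => q0 <-.
rewrite (dot_mon_le _ shape) (side_whole (@on_shellC K M) t2).
apply: leq_trans le _; apply: (two_tree_weight_ge shape (three_legs kin) hH0 t2).
apply: contraNN q0; rewrite -(side_whole (@no_extC K M) t2) => ne.
by rewrite (msq_no_ext kin).
Qed.

Lemma U_R_ssum : U_R G (mom lam) H S =
  ssum setT (fun T => (spanning_tree g 1 T && (weight T <= w0)%N)%:R).
Proof.
rewrite /U_R /leading_part U_lambda_sum leading_sum at_lambda1_sum.
apply: eq_ssum => T _; rewrite is_leading_mon addn0.
by case: (_ <= _)%N; rewrite ?andbF ?andbT.
Qed.

Lemma leading_F_ssum sel : leading_part G (mom lam) H S (F_lambda G (mom lam) sel) =
  ssum setT (fun T => if [&& spanning_tree g 2 T, (weight T + on_shell (farT T) <= w0)%N & sel T]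
                      then - q (farT T) else 0).
Proof.
rewrite /leading_part F_lambda_sum leading_sum at_lambda1_sum.
apply: eq_ssum => T _; rewrite is_leading_mon /Fcoef.
have [t2|] := boolP (spanning_tree g 2 T); last by rewrite if_same.
rewrite (side_whole (@on_shellC K M) t2) (side_whole _ t2) => [|A];
    last exact: (msqC kin).
by case: ifP => _ //; case: ifP.
Qed.

Lemma P0_R_split : P0_R G (mom lam) H S = U_R G (mom lam) H S + F_R G (mom lam) H S.
Proof. by rewrite /P0_R /U_R /F_R /leading_part {2}/LeePomeransky leadingD at_lambda1D. Qed.

(** Term by term: on the right, the term of T appears as often as there are types to which T
    belongs, which is once unless its coefficient vanishes. *)
Lemma F_R_split : F_R G (mom lam) H S =
  \sum_(i < K) Fp_R G (mom lam) H S i + FI_R G (mom lam) H J S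
  + \sum_(i < K) \sum_(j < K | (j < i)%N) FII_R G (mom lam) H J S i j.
Proof.
rewrite /F_R leading_F_ssum.
under eq_bigr => i _ do rewrite /Fp_R leading_F_ssum.
under [X in _ = _ + X]eq_bigr => i _ do under eq_bigr => j _ do rewrite /FII_R leading_F_ssum.
rewrite /FI_R leading_F_ssum /ssum exchange_big /= -big_split /=.
under [X in _ = _ + X]eq_bigr => i _ do rewrite exchange_big.
rewrite exchange_big /= -big_split /=; apply: eq_bigr => T _.
set t2 := spanning_tree g 2 T; set le := (_ <= w0)%N.
pose y := (if t2 && le then - q (farT T) else 0) *: mono R (setT :\: T).
have tm (b : bool) :
    (if [&& t2, le & b] then - q (farT T) else 0) *: mono R (setT :\: T) = y *+ b.
  by rewrite /y andbA; case: b; rewrite ?andbT ?andbF ?scale0r.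
under eq_bigr => i _ do rewrite tm.
under [X in _ = _ + X]eq_bigr => i _ do under eq_bigr => j _ do rewrite tm.
rewrite !tm sumrMnr; under [X in _ = _ + X]eq_bigr => i _ do rewrite sumrMnr.
rewrite sumrMnr -!mulrnDr /y.
have [/andP[T2 lead]|_] := boolP (t2 && le); last by rewrite scale0r !mul0rn.
have [ne|ne] := boolP (no_ext (farT T)).
  by rewrite (msq_no_ext kin) // oppr0 scale0r !mul0rn.
have cases := leading_cases shape (three_legs kin) hH0 (pp_cut_off_shell kin) T2 lead ne.
congr (_ *+ _); apply: etrans (esym cases) _.
congr (_ + _ + _)%N.
- by apply: eq_bigr => i _; rewrite (side_whole (@p_cutC K M i) T2).
- by rewrite (side_whole (@off_shellC K M) T2).
- apply: eq_bigr => i _; apply: eq_bigr => j _.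
  by rewrite (side_whole (@pp_cutC K M i j) T2).
Qed.

Lemma U_H_ssum : U_H R G H J S = ssum H (fun T => (treeH 1 T)%:R).
Proof. exact: Upoly_ssum. Qed.

Lemma U_J_ssum i : U_J R G J S i = ssum (J i) (fun T => (treeJ i 1 T)%:R).
Proof. exact: Upoly_ssum. Qed.

Lemma U_S_ssum : U_S R G S = ssum S (fun T => (treeS 1 T)%:R).
Proof. exact: Upoly_ssum. Qed.

Lemma local_H : local_on H (fun T => (treeH 1 T)%:R : R).
Proof. by move=> T; rewrite -setIA setIid. Qed.

Lemma local_J i : local_on (J i) (fun T => (treeJ i 1 T)%:R : R).
Proof. by move=> T; rewrite -setIA setIid. Qed.

Lemma local_S : local_on S (fun T => (treeS 1 T)%:R : R).
Proof. by move=> T; rewrite -setIA setIid. Qed.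

Lemma natr_andb (a b : bool) : (a && b)%:R = a%:R * b%:R :> R.
Proof. by case: a; rewrite ?mul1r ?mul0r. Qed.

Lemma if_natr (x : R) (b : bool) : (if b then x else 0) = x * b%:R.
Proof. by case: b; rewrite ?mulr1 ?mulr0. Qed.

Lemma prod_natr_bool (P b : pred 'I_K) :
  \prod_(i | P i) (b i)%:R = [forall (i | P i), b i]%:R :> R.
Proof.
have [/forall_inP all_b|] := boolP [forall (i | P i), b i].
  by rewrite big1 // => i /all_b->.
case/forall_inPn => i Pi /negbTE nb.
by rewrite (bigD1 i) //= nb mul0r.
Qed.

Lemma U_J_prod (P : pred 'I_K) : \prod_(i | P i) U_J R G J S i =
  ssum (\bigcup_(i | P i) J i) (fun T => [forall (i | P i), treeJ i 1 T]%:R).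
Proof.
under eq_bigr => i _ do rewrite U_J_ssum.
rewrite (ssum_prod (jet_inj shape) local_J).
by apply: eq_ssum => T _; rewrite prod_natr_bool.
Qed.

Lemma local_jets (P : pred 'I_K) : local_on (\bigcup_(i | P i) J i)
  (fun T => [forall (i | P i), treeJ i 1 T]%:R : R).
Proof.
move=> T; have e T' := prod_natr_bool P (fun i => treeJ i 1 T').
apply: etrans (esym (e _)) _; apply: etrans (e _).
exact: (local_on_prod local_J).
Qed.

Lemma disjoint_H_jets (P : pred 'I_K) : [disjoint H & \bigcup_(i | P i) J i].
Proof.
apply/pred0P => e /=; apply/andP => -[eH /bigcupP[i _]].
by rewrite (hard_jetF shape).
Qed.

Lemma disjoint_H_jet i : [disjoint H & J i].
Proof. by apply/pred0P => e /=; apply/andP => -[eH]; rewrite (hard_jetF shape). Qed.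

Lemma disjoint_jets i (P : pred 'I_K) : ~~ P i -> [disjoint J i & \bigcup_(i | P i) J i].
Proof.
move=> nP; apply/pred0P => e /=; apply/andP => -[ei /bigcupP[j Pj /(jet_inj shape ei) ij]].
by rewrite ij Pj in nP.
Qed.

Lemma disjoint_HJ_S : [disjoint HJ & S].
Proof.
apply/pred0P => e /=; rewrite in_setU; apply/andP => -[/orP[/(hard_softF shape)->//|]].
by case/bigcupP=> i _ /(jet_softF shape)->.
Qed.

Lemma setU_HJS : HJ :|: S = setT.
Proof.
apply/setP=> e; rewrite !in_setU in_setT; have := edge_cover shape e.
case: (e \in H) => //=; case: (e \in S); rewrite ?orbT //= !orbF => /existsP[i ei].
by apply/bigcupP; exists i.
Qed.

Lemma U_R_factor :
  U_R G (mom lam) H S = U_H R G H J S * (\prod_(i < K) U_J R G J S i) * U_S R G S.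
Proof.
rewrite U_R_ssum U_H_ssum U_J_prod U_S_ssum.
rewrite (ssumM (disjoint_H_jets _) local_H (local_jets _)).
rewrite (ssumM disjoint_HJ_S (local_onM local_H (local_jets _)) local_S) setU_HJS.
apply: eq_ssum => T _; rewrite (leading_tree shape).
have -> : [forall i, treeJ i 1 T] = [forall (i | true), treeJ i 1 T] by apply: eq_forallb.
by rewrite !natr_andb mulrA.
Qed.

Lemma msq_splits (A B : {set leg K M}) : splits B A -> q A = q B.
Proof. by case/orP=> /eqP <-; rewrite // (msqC kin). Qed.

Lemma side_contracted (X : Type) (f : {set leg K M} -> X) W F T :
  (forall A, f (~: A) = f A) -> spanning_tree (contracted G W F) 2 T ->
  f (side (contracted G W F) T) = f (far (contracted G W F) T None).
Proof.
move=> fC /and3P[_ /eqP cT _].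
have wT : ends_in (contracted G W F) (verts (contracted G W F)) T by exact: ends_contracted.
have NV : None \in verts (contracted G W F) by rewrite !inE.
have attV l : att (contracted G W F) l \in verts (contracted G W F) by exact: contracted_verts.
by have [->|->] := side_far wT cT NV attV; rewrite ?fC.
Qed.

Lemma Fp_R_factor i : Fp_R G (mom lam) H S i =
  U_H R G H J S * Fp_J G (mom lam) J S i * (\prod_(j < K | j != i) U_J R G J S j) * U_S R G S.
Proof.
(* All cuts in question share this kinematic factor, whichever side is taken, so both coefficient
   functions are p times conditions on traces, up to sign. *)
pose p := q [set inl i].
pose cJ T := if treeJ i 2 T && p_cut i (far (jet_tilde G J S i) (T :&: J i) None) then - p else 0.
have FJ : Fp_J G (mom lam) J S i = ssum (J i) cJ.
  apply: etrans (Fpoly_ssum _ _ _) _; apply: eq_ssum => T _; rewrite /cJ /=.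
  have [t2|//] := boolP (treeJ i 2 T).
  rewrite (side_contracted (@p_cutC K M i) t2) (side_contracted _ t2) => [|A];
    last exact: (msqC kin).
  by case: ifP => // /msq_splits->.
have lJ : local_on (J i) cJ by move=> T; rewrite /cJ -setIA setIid.
rewrite /Fp_R leading_F_ssum FJ U_H_ssum U_J_prod U_S_ssum.
rewrite (ssumM (disjoint_H_jet i) local_H lJ).
have HJi : H :|: J i :|: \bigcup_(j | j != i) J j = HJ.
  by rewrite -setUA [in RHS](bigD1 i).
have dJ : [disjoint H :|: J i & \bigcup_(j | j != i) J j].
  rewrite -setI_eq0 setIUl setU_eq0 !setI_eq0 disjoint_H_jets disjoint_jets //.
  by rewrite eqxx.
rewrite (ssumM dJ (local_onM local_H lJ) (local_jets _)) HJi.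
have lHJ := local_onM (local_onM local_H lJ) (local_jets (fun j => j != i)); rewrite HJi in lHJ.
rewrite (ssumM disjoint_HJ_S lHJ local_S) setU_HJS; apply: eq_ssum => T _.
transitivity (if [&& spanning_tree g 2 T, (weight T + on_shell (farT T) <= w0)%N
                   & p_cut i (farT T)] then - p else 0).
  have [t2|//] := boolP (spanning_tree g 2 T); rewrite (side_whole (@p_cutC K M i) t2).
  by case: (_ <= _)%N => //=; case: ifP => // /msq_splits->.
rewrite (leading_p_cut shape hH0 (three_legs kin)) /cJ.
case: (treeH 1 T); rewrite ?mul0r //= mul1r.
case: (treeJ i 2 T); rewrite ?mul0r //=.
case: (p_cut i _); rewrite ?mul0r //=.
by rewrite -mulrA -natr_andb; case: andb; rewrite ?mulr1 ?mulr0.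
Qed.

(** The kinematic factor varies with T here, so the cut made by the trace on HJ has to be the same
    set of legs as the cut made by T; this is [far_HJ]. *)
Lemma FI_R_factor :
  FI_R G (mom lam) H J S = Fq_HJ G (mom lam) H J S * U_S R G S.
Proof.
pose hj := hard_jet_graph G H J S.
pose cHJ T := if [&& treeHJ 2 T, off_shell (far hj (T :&: HJ) h0) & treeH 2 T]
              then - q (far hj (T :&: HJ) h0) else 0.
have setIHJ T : T :&: HJ :&: H = T :&: H by rewrite -setIA setUK.
have side_hj (X : Type) (f : {set leg K M} -> X) T : (forall A, f (~: A) = f A) ->
    treeHJ 2 T -> f (side hj (T :&: HJ)) = f (far hj (T :&: HJ) h0).
  move=> fC /and3P[_ /eqP cT _].
  have wT : ends_in hj (verts hj) (T :&: HJ).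
    rewrite /= -(nonsoft_verts shape); apply: ends_inS (ends_HJ shape) => //.
    exact: subsetIr.
  have h0V : h0 \in verts hj by rewrite in_setU hH0.
  have attV l : att hj l \in verts hj.
    by rewrite /= -(nonsoft_verts shape) (att_nonsoft shape).
  by have [->|->] := side_far wT cT h0V attV; rewrite ?fC.
have FHJ : Fq_HJ G (mom lam) H J S = ssum HJ cHJ.
  apply: etrans (Fpoly_ssum _ _ _) _; apply: eq_ssum => T _; rewrite /cHJ /= setIHJ.
  have [t2|//] := boolP (treeHJ 2 T).
  by rewrite (side_hj _ _ _ (@off_shellC K M) t2) (side_hj _ _ _ _ t2) => [|A];
    last exact: (msqC kin).
have lHJ : local_on HJ cHJ by move=> T; rewrite /cHJ setIHJ -setIA setIid.
rewrite /FI_R leading_F_ssum FHJ U_S_ssum (ssumM disjoint_HJ_S lHJ local_S) setU_HJS.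
apply: eq_ssum => T _.
transitivity (if [&& spanning_tree g 2 T, (weight T + on_shell (farT T) <= w0)%N,
                     off_shell (farT T) & treeH 2 T] then - q (farT T) else 0).
  by have [t2|//] := boolP (spanning_tree g 2 T); rewrite (side_whole (@off_shellC K M) t2).
have lead := leading_hard_cut shape hH0 T; rewrite lead /cHJ.
have [/and4P[tY off tH tS]|] := boolP [&& _, _, _ & _].
  rewrite tY off tH tS mulr1 /=.
  have /and4P[] : [&& spanning_tree g 2 T, (weight T + on_shell (farT T) <= w0)%N,
                     off_shell (farT T) & treeH 2 T] by rewrite lead tY off tH tS.
  case/and3P=> _ /eqP cT _ _ _ _.
  by rewrite (far_HJ shape hH0 cT tY (soft_tree_ncomp shape tS)).
case: (treeS 1 T); last by rewrite mulr0.
by rewrite mulr1 andbT => /negbTE->.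
Qed.

(** The condition of being a 2-tree of [jet_jet_soft] couples the traces on J_i, J_j and S, which
    therefore stay in one factor; H and the other jets split off. *)
Lemma FII_R_factor i j : j != i -> FII_R G (mom lam) H J S i j =
  U_H R G H J S * Fqij_JJS G (mom lam) J S i j
  * \prod_(k < K | (k != i) && (k != j)) U_J R G J S k.
Proof.
move=> nji; have nij : i != j by rewrite eq_sym.
pose p := q [set inl i; inl j].
pose jjs_graph := jet_jet_soft G J S i j.
pose cJ T := if [&& treeJJS i j 2 T, pp_cut i j (far jjs_graph (T :&: jjs i j) None),
    treeJ i 2 T, treeJ j 2 T & loops (soft_tilde G S) (T :&: S) == 1%N] then - p else 0.
have setIi T : T :&: jjs i j :&: J i = T :&: J i by rewrite -setIA -setUA setUK.
have setIj T : T :&: jjs i j :&: J j = T :&: J j.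
  by rewrite -setIA [J i :|: J j]setUC -setUA setUK.
have setIS T : T :&: jjs i j :&: S = T :&: S by rewrite -setIA [_ :&: S]setIC setKU.
have FJ : Fqij_JJS G (mom lam) J S i j = ssum (jjs i j) cJ.
  apply: etrans (Fpoly_ssum _ _ _) _; apply: eq_ssum => T _; rewrite /cJ /= setIi setIj setIS.
  have [t2|//] := boolP (treeJJS i j 2 T).
  rewrite (side_contracted (@pp_cutC K M i j) t2) (side_contracted _ t2) => [|A];
    last exact: (msqC kin).
  by case: ifP => // /and3P[_ /msq_splits-> _].
have lJ : local_on (jjs i j) cJ.
  by move=> T; rewrite /cJ setIi setIj setIS -setIA setIid.
rewrite /FII_R leading_F_ssum FJ U_H_ssum U_J_prod.
have dH : [disjoint H & jjs i j].
  rewrite disjoint_sym -setI_eq0 !setIUl !setU_eq0 !setI_eq0.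
  rewrite ![[disjoint _ & H]]disjoint_sym !disjoint_H_jet /=.
  by apply/pred0P => e /=; apply/andP => -[/(hard_softF shape)->].
rewrite (ssumM dH local_H lJ).
have dJ : [disjoint H :|: jjs i j & \bigcup_(k | (k != i) && (k != j)) J k].
  rewrite -setI_eq0 !setIUl !setU_eq0 !setI_eq0 disjoint_H_jets !disjoint_jets ?eqxx ?andbF //=.
  apply/pred0P => e /=; apply/andP => -[eS /bigcupP[k _ /(jet_softF shape)]].
  by rewrite eS.
rewrite (ssumM dJ (local_onM local_H lJ) (local_jets _)).
have -> : H :|: jjs i j :|: \bigcup_(k | (k != i) && (k != j)) J k = setT.
  rewrite -setU_HJS; apply/setP=> e; rewrite !in_setU.
  rewrite [in RHS](bigD1 i) //= [in RHS](bigD1 j) //= !in_setU.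
  by case: (e \in H); case: (e \in J i); case: (e \in J j); case: (e \in S); rewrite ?orbT ?orbF.
apply: eq_ssum => T _.
transitivity (if [&& spanning_tree g 2 T, (weight T + on_shell (farT T) <= w0)%N,
    pp_cut i j (farT T), treeH 1 T, treeJ i 2 T, treeJ j 2 T
    & loops (soft_tilde G S) (T :&: S) == 1%N] then - p else 0).
  have [t2|//] := boolP (spanning_tree g 2 T); rewrite (side_whole (@pp_cutC K M i j) t2).
  by case: (_ <= _)%N => //=; case: ifP => // /andP[/msq_splits->].
rewrite (leading_pp_cut shape hH0 T nij) => [|A]; last exact: (pp_cut_off_shell kin).
rewrite /cJ; case: (treeH 1 T); rewrite ?mul0r //= mul1r.
case: (treeJJS i j 2 T); rewrite ?mul0r //=; case: (pp_cut i j _); rewrite ?mul0r //=.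
case: (treeJ i 2 T); rewrite ?mul0r //=; case: (treeJ j 2 T); rewrite ?mul0r //=.
case: (_ == 1%N); rewrite ?mul0r //=.
by apply: (if_natr (- p)).
Qed.

End Factorisation.

Theorem theorem2 (R : realFieldType) (d K M N : nat) (V : finType)
    (G : feynman_graph K M N V)
    (lam1 Q2 : R) (mom : R -> leg K M -> 'rV[R]_d.+1) (lam : R)
    (H : {set 'I_N}) (J : 'I_K -> {set 'I_N}) (S : {set 'I_N}) :
  ncomp (whole G) setT = 1%N ->
  wide_angle G lam1 Q2 mom ->
  0 < lam <= lam1 ->
  is_region G (mom lam) H J S ->
  [/\ P0_R G (mom lam) H S = U_R G (mom lam) H S + F_R G (mom lam) H S,
      F_R G (mom lam) H S =
        \sum_(i < K) Fp_R G (mom lam) H S i + FI_R G (mom lam) H J S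
        + \sum_(i < K) \sum_(j < K | (j < i)%N) FII_R G (mom lam) H J S i j
    & [/\ U_R G (mom lam) H S =
            U_H R G H J S * (\prod_(i < K) U_J R G J S i) * U_S R G S,
          forall i : 'I_K, Fp_R G (mom lam) H S i =
            U_H R G H J S * Fp_J G (mom lam) J S i
            * (\prod_(j < K | j != i) U_J R G J S j) * U_S R G S,
          FI_R G (mom lam) H J S = Fq_HJ G (mom lam) H J S * U_S R G S
        & forall i j : 'I_K, (j < i)%N ->
            FII_R G (mom lam) H J S i j =
            U_H R G H J S * Fqij_JJS G (mom lam) J S i j
            * \prod_(k < K | (k != i) && (k != j)) U_J R G J S k]].
Proof.
move=> connG kin lamP [shape _]; have [h0 hH0] := hard_nonempty shape.
split; [exact: P0_R_split | exact: (F_R_split connG kin lamP shape hH0) | split].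
- exact: (U_R_factor connG kin lamP shape hH0).
- exact: (Fp_R_factor connG kin lamP shape hH0).
- exact: (FI_R_factor connG kin lamP shape hH0).
- move=> i j ji; apply: (FII_R_factor connG kin lamP shape hH0).
  by apply: contraTneq ji => ->; rewrite ltnn.
Qed.
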